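(* In the space $\mathcal{C}(\mathbb{T}^{\mathbb{N}})$ of connected compact subgroups of $\mathbb{T}^{\mathbb{N}}$, equipped with the Hausdorff metric, the set of groups that are isomorphic (as topological groups) to the universal solenoid is comeager.
   Context: Let $\mathbb{T}=\mathbb{R}/\mathbb{Z}$ be the circle group with its usual quotient metric $d_{\mathbb{T}}$ (diameter $1/2$). Let $\mathbb{T}^{\mathbb{N}}$ be the countable product of copies of $\mathbb{T}$, with metric $d(x,y)=\sum_{n=0}^\infty 2^{-n} d_{\mathbb{T}}(x(n),y(n))$. For a metric group $G$, $\mathcal{K}(G)$ is the set of nonempty compact subsets of $G$ with the Hausdorff metric $d_H(K,L)=\inf\{\varepsilon>0: K_\varepsilon\supseteq L,\ L_\varepsilon\supseteq K\}$ ($A_\varepsilon$ the open $\varepsilon$-neighborhood of $A$), and $\mathcal{C}(G)=\{K\in\mathcal{K}(G): K \text{ is a connected subgroup of } G\}$. Every connected compact metrizable abelian group is isomorphic to an element of $\mathcal{C}(\mathbb{T}^{\mathbb{N}})$. A solenoid is the inverse limit of the inverse system $(S_i,f_i)_{i\in\mathbb{N}}$ where each $S_i=\mathbb{T}$ and $f_i:S_{i+1}\to S_i$ is $x\mapsto p_i x \pmod 1$ for a sequence of primes $(p_0,p_1,\dots)$. The universal solenoid is the solenoid associated to a sequence of primes in which every prime occurs infinitely many times. Comeager means: complement is a countable union of nowhere dense sets. *)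

(* Defs.v *)
From Stdlib Require Import Reals ZArith Znumtheory.
From Coquelicot Require Import Coquelicot.
Open Scope R_scope.

(* A point of T^N is represented by its canonical representative:
   a sequence x : nat -> R with 0 <= x n < 1 for all n. *)
Definition TN := nat -> R.
Definition canon (x : TN) : Prop := forall n, 0 <= x n < 1.

(* quotient metric on T: distance from a-b to the nearest integer *)
Definition dT (a b : R) : R :=
  Rmin (frac_part (a - b)) (1 - frac_part (a - b)).

Definition d (x y : TN) : R := Series (fun n => (/ 2) ^ n * dT (x n) (y n)).

Definition tzero : TN := fun _ => 0.
Definition tadd (x y : TN) : TN := fun n => frac_part (x n + y n).
Definition tneg (x : TN) : TN := fun n => frac_part (- x n).

Definition TSet := TN -> Prop.

Definition Topen (U : TSet) : Prop :=
  forall x, canon x -> U x ->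
    exists eps, 0 < eps /\ forall y, canon y -> d x y < eps -> U y.

Definition Tcompact (K : TSet) : Prop :=
  (forall x, K x -> canon x) /\
  forall (I : Type) (U : I -> TSet),
    (forall i, Topen (U i)) ->
    (forall x, K x -> exists i, U i x) ->
    exists l : list I, forall x, K x -> exists i, List.In i l /\ U i x.

Definition rel_open (K A : TSet) : Prop :=
  forall x, A x -> exists eps, 0 < eps /\ forall y, K y -> d x y < eps -> A y.

Definition Tconnected (K : TSet) : Prop :=
  ~ exists A B : TSet,
      rel_open K A /\ rel_open K B /\
      (forall x, A x -> K x) /\ (forall x, B x -> K x) /\
      (forall x, K x -> A x \/ B x) /\
      (forall x, ~ (A x /\ B x)) /\
      (exists a, A a) /\ (exists b, B b).

Definition Tsubgroup (K : TSet) : Prop :=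
  K tzero /\ (forall x y, K x -> K y -> K (tadd x y)) /\
  (forall x, K x -> K (tneg x)).

Definition inK (K : TSet) : Prop := Tcompact K /\ exists x, K x.

Definition inC (K : TSet) : Prop := inK K /\ Tsubgroup K /\ Tconnected K.

Definition nbhd_contains (A : TSet) (eps : R) (B : TSet) : Prop :=
  forall x, B x -> exists y, A y /\ d y x < eps.

Definition dH (K L : TSet) : Rbar :=
  Glb_Rbar (fun eps => 0 < eps /\ nbhd_contains K eps L /\ nbhd_contains L eps K).

Definition HSet := TSet -> Prop.

Definition Cclosure (N : HSet) : HSet :=
  fun K => inC K /\ forall r, 0 < r ->
    exists L, inC L /\ N L /\ Rbar_lt (dH K L) (Finite r).

Definition nowhere_dense_C (N : HSet) : Prop :=
  ~ exists K r, inC K /\ 0 < r /\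
      forall L, inC L -> Rbar_lt (dH K L) (Finite r) -> Cclosure N L.

Definition comeager_C (P : HSet) : Prop :=
  exists N : nat -> HSet,
    (forall n, nowhere_dense_C (N n)) /\
    (forall K, inC K -> ~ P K -> exists n, N n K).

(* inverse limit of (T, x |-> p_i x mod 1), as a subgroup of T^N *)
Definition solenoid (p : nat -> nat) : TSet :=
  fun x => canon x /\ forall i, x i = frac_part (INR (p i) * x (S i)).

Definition universal_prime_seq (p : nat -> nat) : Prop :=
  (forall i, prime (Z.of_nat (p i))) /\
  (forall q, prime (Z.of_nat q) -> forall N, exists i, (N <= i)%nat /\ p i = q).

Definition cont_on (K : TSet) (f : TN -> TN) : Prop :=
  forall x, K x -> forall eps, 0 < eps ->
    exists delta, 0 < delta /\ forall y, K y -> d x y < delta -> d (f x) (f y) < eps.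

Definition top_group_iso (K S : TSet) : Prop :=
  exists f g : TN -> TN,
    (forall x, K x -> S (f x)) /\ (forall y, S y -> K (g y)) /\
    (forall x, K x -> forall n, g (f x) n = x n) /\
    (forall y, S y -> forall n, f (g y) n = y n) /\
    (forall x y, K x -> K y -> forall n, f (tadd x y) n = tadd (f x) (f y) n) /\
    cont_on K f /\ cont_on S g.

Definition iso_universal_solenoid (K : TSet) : Prop :=
  exists p, universal_prime_seq p /\ top_group_iso K (solenoid p).

(* Main.v *)
(** Call K good at level n if some coordinate x_M satisfies x_j = n! k_j x_M on K
    for all j < n, with integers k_j.  On a subgroup it suffices that the two
    sides differ by less than 1/4 everywhere, so goodness is an open condition.
    It is dense because every connected compact K is close to a circle
    (a_j t)_(j < m): small elements of K lie on one-parameter subgroups, so by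
    connectedness all elements do; by Dirichlet's theorem each such line stays
    close to a closed one, and two circles a, b inside a neighbourhood of K are
    jointly approximated by the single circle a + Q b with Q large.
    Reparametrising t as n! t and placing t itself in the remote coordinate m
    makes the circle good at level n.

    Conversely, if K is nontrivial and good at every level, its coordinate
    characters generate a divisible torsion-free group of rank one.  Starting from
    a nonzero coordinate one extracts successive p_i-th roots h_i x_(M i), and
    x |-> (h_i x_(M i))_i is an isomorphism onto the solenoid of (p_i). *)

Require Import Defs.
From Stdlib Require Import Reals ZArith Znumtheory Lra Lia List.
From Stdlib Require Import Classical ClassicalEpsilon FunctionalExtensionality.
From Coquelicot Require Import Coquelicot.
Open Scope R_scope.

Lemma choice {A B : Type} (P : A -> B -> Prop) :
  (forall a, exists b, P a b) -> exists f, forall a, P a (f a).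
Proof.
  intros H.
  exists (fun a => proj1_sig (constructive_indefinite_description _ (H a))).
  intros a; apply proj2_sig.
Qed.

(** * Congruence modulo 1 and the distance to the nearest integer *)

Definition isint (r : R) : Prop := exists k : Z, r = IZR k.

(** [dT a b] unfolds to [nt (a - b)], so estimates on the circle become estimates on differences of
    real numbers. *)
Definition nt (r : R) : R := Rmin (frac_part r) (1 - frac_part r).

Lemma isint_plus a b : isint a -> isint b -> isint (a + b).
Proof. intros [k ->] [l ->]; exists (k + l)%Z; now rewrite plus_IZR. Qed.

Lemma isint_opp a : isint a -> isint (- a).
Proof. intros [k ->]; exists (- k)%Z; now rewrite opp_IZR. Qed.

Lemma isint_minus a b : isint a -> isint b -> isint (a - b).
Proof. intros; apply isint_plus; auto using isint_opp. Qed.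

Lemma isint_mult a b : isint a -> isint b -> isint (a * b).
Proof. intros [k ->] [l ->]; exists (k * l)%Z; now rewrite mult_IZR. Qed.

Lemma isint_IZR k : isint (IZR k).
Proof. now exists k. Qed.

Lemma isint_INR n : isint (INR n).
Proof. exists (Z.of_nat n); apply INR_IZR_INZ. Qed.

Lemma isint_0 : isint 0.
Proof. now exists 0%Z. Qed.

Lemma frac_bounds r : 0 <= frac_part r < 1.
Proof. destruct (base_fp r); lra. Qed.

Lemma frac_isint r : isint (r - frac_part r).
Proof. exists (Int_part r); unfold frac_part; lra. Qed.

(** Turns congruence modulo 1 back into equality of canonical representatives. *)
Lemma isint_lt1_eq a b : 0 <= a < 1 -> 0 <= b < 1 -> isint (a - b) -> a = b.
Proof.
  intros Ha Hb [k Hk].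
  assert (k = 0)%Z as ->.
  { assert (-1 < k < 1)%Z; [|lia].
    split; apply lt_IZR; lra. }
  lra.
Qed.

Lemma frac_eq a b : isint (a - b) -> frac_part a = frac_part b.
Proof.
  intros H; apply isint_lt1_eq; auto using frac_bounds.
  replace (frac_part a - frac_part b)
    with (a - b - (a - frac_part a) + (b - frac_part b)) by ring.
  apply isint_plus; [apply isint_minus|]; auto using frac_isint.
Qed.

Lemma frac_id a : 0 <= a < 1 -> frac_part a = a.
Proof.
  intros H; apply isint_lt1_eq; auto using frac_bounds.
  replace (frac_part a - a) with (- (a - frac_part a)) by ring.
  apply isint_opp, frac_isint.
Qed.

Lemma nt_le r k : nt r <= Rabs (r - IZR k).
Proof.
  unfold nt; destruct (frac_bounds r) as [H0 H1].
  destruct (frac_isint r) as [l Hl].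
  replace (r - IZR k) with (frac_part r + IZR (l - k)) by (rewrite minus_IZR; lra).
  destruct (Z_lt_le_dec (l - k) 0) as [H|H].
  - assert (IZR (l - k) <= -1) by (apply IZR_le; lia).
    eapply Rle_trans; [apply Rmin_r|].
    rewrite Rabs_left1; lra.
  - apply IZR_le in H.
    eapply Rle_trans; [apply Rmin_l|].
    rewrite Rabs_pos_eq; lra.
Qed.

Lemma nt_ex r : exists k, nt r = Rabs (r - IZR k).
Proof.
  destruct (frac_bounds r) as [H0 H1].
  destruct (frac_isint r) as [l Hl].
  unfold nt, Rmin; destruct Rle_dec.
  - exists l; rewrite Rabs_pos_eq; lra.
  - exists (l + 1)%Z; rewrite plus_IZR, Rabs_left1; lra.
Qed.

Lemma nt_pos r : 0 <= nt r.
Proof. destruct (nt_ex r) as [k ->]; apply Rabs_pos. Qed.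

Lemma nt_half r : nt r <= / 2.
Proof. unfold nt, Rmin; destruct Rle_dec; lra. Qed.

Lemma nt_le_abs r : nt r <= Rabs r.
Proof. pose proof (nt_le r 0) as H; now rewrite Rminus_0_r in H. Qed.

Lemma nt_plus a b : nt (a + b) <= nt a + nt b.
Proof.
  destruct (nt_ex a) as [k ->], (nt_ex b) as [l ->].
  eapply Rle_trans; [apply (nt_le _ (k + l))|].
  rewrite plus_IZR.
  replace (a + b - (IZR k + IZR l)) with ((a - IZR k) + (b - IZR l)) by ring.
  apply Rabs_triang.
Qed.

Lemma nt_opp a : nt (- a) = nt a.
Proof.
  assert (H : forall x, nt (- x) <= nt x).
  { intros x; destruct (nt_ex x) as [k ->].
    eapply Rle_trans; [apply (nt_le _ (- k))|].
    rewrite opp_IZR, <- (Rabs_Ropp (x - IZR k)).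
    right; f_equal; ring. }
  apply Rle_antisym; auto.
  rewrite <- (Ropp_involutive a) at 1; auto.
Qed.

Lemma nt_sym a b : nt (a - b) = nt (b - a).
Proof. rewrite <- nt_opp; f_equal; ring. Qed.

Lemma nt_triang a b c : nt (a - c) <= nt (a - b) + nt (b - c).
Proof. replace (a - c) with ((a - b) + (b - c)) by ring; apply nt_plus. Qed.

Lemma nt_isint a : isint a -> nt a = 0.
Proof.
  intros [k ->]; apply Rle_antisym; [|apply nt_pos].
  eapply Rle_trans; [apply (nt_le _ k)|].
  rewrite Rminus_diag, Rabs_R0; lra.
Qed.

Lemma isint_nt a : nt a = 0 -> isint a.
Proof.
  destruct (nt_ex a) as [k ->]; intros H; exists k.
  destruct (Req_dec (a - IZR k) 0) as [E|E]; [lra|].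
  now apply Rabs_no_R0 in E.
Qed.

Lemma nt_congr a b : isint (a - b) -> nt a = nt b.
Proof. intros H; unfold nt; now rewrite (frac_eq a b). Qed.

Lemma nt_mulZ k a : nt (IZR k * a) <= Rabs (IZR k) * nt a.
Proof.
  destruct (nt_ex a) as [l ->].
  eapply Rle_trans; [apply (nt_le _ (k * l))|].
  rewrite mult_IZR, <- Rabs_mult; right; f_equal; ring.
Qed.

(** Any nonzero integer lies at distance at least 1/2 from [r], so 0 is a nearest one. *)
Lemma nt_abs r : Rabs r <= / 2 -> nt r = Rabs r.
Proof.
  intros H; apply Rle_antisym; [apply nt_le_abs|].
  destruct (nt_ex r) as [k ->].
  destruct (Z.eq_dec k 0) as [->|Hk]; [rewrite Rminus_0_r; lra|].
  assert (H1 : 1 <= Rabs (IZR k)).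
  { rewrite <- abs_IZR; apply IZR_le; lia. }
  pose proof (Rabs_triang (IZR k - r) r) as H2.
  replace (IZR k - r + r) with (IZR k) in H2 by ring.
  rewrite (Rabs_minus_sym r); lra.
Qed.

(* Doubling doubles the distance to Z as long as it stays below 1/4. *)
Lemma isint_of_small_multiples a :
  (forall k, nt (IZR k * a) < / 4) -> isint a.
Proof.
  intros H; apply isint_nt.
  assert (D : forall x, nt x < / 4 -> nt (2 * x) = 2 * nt x).
  { intros x Hx; destruct (nt_ex x) as [k Hk].
    rewrite (nt_congr (2 * x) (2 * (x - IZR k))).
    - rewrite nt_abs; rewrite Rabs_mult, (Rabs_pos_eq 2) by lra; lra.
    - exists (2 * k)%Z; rewrite mult_IZR; ring. }
  assert (P : forall n, nt (IZR (2 ^ Z.of_nat n) * a) = 2 ^ n * nt a).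
  { induction n as [|n IH].
    - simpl; rewrite !Rmult_1_l; auto.
    - rewrite Nat2Z.inj_succ, Z.pow_succ_r, mult_IZR by lia.
      rewrite Rmult_assoc, D, IH by auto; simpl; ring. }
  destruct (Rle_lt_or_eq_dec _ _ (nt_pos a)) as [Ha|Ha]; auto.
  exfalso.
  destruct (Pow_x_infinity 2) with (b := / nt a) as [N HN].
  { rewrite Rabs_pos_eq; lra. }
  specialize (HN N (le_n _)).
  rewrite Rabs_pos_eq in HN by (apply pow_le; lra).
  specialize (H (2 ^ Z.of_nat N)%Z); rewrite P in H.
  apply Rge_le, (Rmult_le_compat_r (nt a)) in HN; [|lra].
  rewrite Rinv_l in HN by lra; lra.
Qed.

Lemma frac_nt a b : nt (frac_part a - frac_part b) = nt (a - b).
Proof.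
  apply nt_congr.
  replace (frac_part a - frac_part b - (a - b))
    with (- (a - frac_part a) + (b - frac_part b)) by ring.
  apply isint_plus; [apply isint_opp|]; apply frac_isint.
Qed.

(** * The product metric and its coordinates *)

Lemma geom_series q : 0 <= q < 1 -> is_series (fun n => q ^ n) (/ (1 - q)).
Proof. intros H; apply is_series_geom; rewrite Rabs_pos_eq; lra. Qed.

Lemma d_term_pos (x y : TN) n : 0 <= (/ 2) ^ n * dT (x n) (y n).
Proof. apply Rmult_le_pos; [apply pow_le; lra | apply nt_pos]. Qed.

Lemma d_ex (x y : TN) : ex_series (fun n => (/ 2) ^ n * dT (x n) (y n)).
Proof.
  apply (ex_series_le (V := R_CompleteNormedModule) _ (fun n => (/ 2) ^ n)).
  - intros n; change (Rabs ((/ 2) ^ n * dT (x n) (y n)) <= (/ 2) ^ n).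
    rewrite Rabs_pos_eq by apply d_term_pos.
    rewrite <- Rmult_1_r; apply Rmult_le_compat_l; [apply pow_le; lra|].
    pose proof (nt_half (x n - y n)); unfold dT; fold (nt (x n - y n)); lra.
  - exists (/ (1 - / 2)); apply geom_series; lra.
Qed.

Lemma Series_pos a : (forall n, 0 <= a n) -> ex_series a -> 0 <= Series a.
Proof.
  intros H E.
  replace 0 with (Series (fun n => 0 * a n)) by (rewrite Series_scal_l; ring).
  apply Series_le; auto; intros n; specialize (H n); lra.
Qed.

Lemma d_pos x y : 0 <= d x y.
Proof. apply Series_pos; [apply d_term_pos | apply d_ex]. Qed.

Lemma d_sym x y : d x y = d y x.
Proof.
  apply Series_ext; intros n; f_equal.
  apply (nt_sym (x n) (y n)).
Qed.

Lemma d_refl x : d x x = 0.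
Proof.
  unfold d; rewrite (Series_ext _ (fun n => 0 * 0)), Series_scal_l; [ring|].
  intros n; change (dT (x n) (x n)) with (nt (x n - x n)).
  rewrite Rminus_diag, nt_isint by apply isint_0; ring.
Qed.

Lemma d_triang x y z : d x z <= d x y + d y z.
Proof.
  unfold d; rewrite <- Series_plus by apply d_ex.
  apply Series_le.
  - intros n; split; [apply d_term_pos|].
    rewrite <- Rmult_plus_distr_l; apply Rmult_le_compat_l; [apply pow_le; lra|].
    apply (nt_triang (x n) (y n) (z n)).
  - apply (ex_series_plus (V := R_NormedModule)); apply d_ex.
Qed.

(** A single term of a series with nonnegative terms is at most its sum. *)
Lemma d_coord x y n : nt (x n - y n) <= 2 ^ n * d x y.
Proof.
  assert (H : (/ 2) ^ n * nt (x n - y n) <= d x y).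
  { unfold d; rewrite (Series_incr_n _ (S n)) by (auto using d_ex; lia); simpl pred.
    assert (0 <= Series (fun k => (/ 2) ^ (S n + k) * dT (x (S n + k)%nat) (y (S n + k)%nat))).
    { apply Series_pos; [intros; apply d_term_pos|].
      apply (ex_series_incr_n (fun n => (/ 2) ^ n * dT (x n) (y n)) (S n)), d_ex. }
    enough ((/ 2) ^ n * nt (x n - y n) <=
            sum_f_R0 (fun n => (/ 2) ^ n * dT (x n) (y n)) n) by lra.
    destruct n as [|n]; [simpl; unfold nt, dT; lra|].
    rewrite tech5.
    assert (0 <= sum_f_R0 (fun n => (/ 2) ^ n * dT (x n) (y n)) n)
      by (apply cond_pos_sum; intros; apply d_term_pos).
    unfold nt, dT in *; lra. }
  apply (Rmult_le_compat_l (2 ^ n)) in H; [|apply pow_le; lra].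
  rewrite <- Rmult_assoc, <- Rpow_mult_distr, Rinv_r, pow1, Rmult_1_l in H; lra.
Qed.

(** The tail of the series is uniformly small, so closeness in [d] only has to be checked on
    finitely many coordinates. *)
Lemma d_small e : 0 < e -> exists m eta, 0 < eta /\
  forall x y, (forall j, (j < m)%nat -> nt (x j - y j) < eta) -> d x y < e.
Proof.
  intros He.
  (* Writing (1/2)^n as (2/3)^n (3/4)^n, the choice of [m] bounds every term by (e/8) (3/4)^n, a
     series with sum e/2. *)
  destruct (pow_lt_1_zero (2 / 3)) with (y := e / 8) as [m Hm];
    [rewrite Rabs_pos_eq; lra | lra |].
  specialize (Hm m (le_n _)).
  rewrite Rabs_pos_eq in Hm by (apply pow_le; lra).
  exists m, (e / 16); split; [lra|]; intros x y H.
  assert (G : is_series (fun n => (e / 8) * (3 / 4) ^ n) ((e / 8) * / (1 - 3 / 4))).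
  { apply (is_series_scal_l (K := R_AbsRing) (e / 8) _ (/ (1 - 3 / 4))), geom_series; lra. }
  apply Rle_lt_trans with ((e / 8) * / (1 - 3 / 4)); [|lra].
  rewrite <- (is_series_unique _ _ G).
  apply Series_le; [|eexists; exact G].
  intros n; split; [apply d_term_pos|].
  assert (T : 0 < (/ 2) ^ n) by (apply pow_lt; lra).
  assert (T' : (/ 2) ^ n <= (3 / 4) ^ n) by (apply pow_incr; lra).
  unfold dT; fold (nt (x n - y n)).
  destruct (lt_dec n m) as [L|L].
  - specialize (H n L).
    pose proof (nt_pos (x n - y n)); nra.
  - pose proof (nt_half (x n - y n)).
    replace ((/ 2) ^ n) with ((2 / 3) ^ n * (3 / 4) ^ n)
      by (rewrite <- Rpow_mult_distr; f_equal; field).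
    assert (T3 : (2 / 3) ^ n <= (2 / 3) ^ m).
    { replace n with (m + (n - m))%nat by lia.
      rewrite pow_add.
      assert ((2 / 3) ^ (n - m) <= 1) by (rewrite <- (pow1 (n - m)); apply pow_incr; lra).
      assert (0 < (2 / 3) ^ m) by (apply pow_lt; lra).
      nra. }
    assert (0 <= (2 / 3) ^ n) by (apply pow_le; lra).
    pose proof (nt_pos (x n - y n)).
    assert ((2 / 3) ^ n * nt (x n - y n) <= e / 8) by nra.
    nra.
Qed.

(** * Finite-dimensional sup norm *)

Fixpoint nm (m : nat) (v : nat -> R) : R :=
  match m with O => 0 | S m => Rmax (nm m v) (Rabs (v m)) end.

Lemma nm_pos m v : 0 <= nm m v.
Proof. induction m; simpl; [lra|]; eapply Rle_trans; [exact IHm|apply Rmax_l]. Qed.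

Lemma nm_coord m v j : (j < m)%nat -> Rabs (v j) <= nm m v.
Proof.
  induction m; simpl; [lia|]; intros H.
  destruct (Nat.eq_dec j m) as [->|]; [apply Rmax_r|].
  eapply Rle_trans; [apply IHm; lia|apply Rmax_l].
Qed.

Lemma nm_le m v B : 0 <= B -> (forall j, (j < m)%nat -> Rabs (v j) <= B) -> nm m v <= B.
Proof. intros HB; induction m; simpl; intros H; [lra|]; apply Rmax_lub; auto. Qed.

Lemma nm_lt m v B : 0 < B -> (forall j, (j < m)%nat -> Rabs (v j) < B) -> nm m v < B.
Proof. intros HB; induction m; simpl; intros H; [lra|]; apply Rmax_lub_lt; auto. Qed.

Lemma nm_lt_coord m v B j : nm m v < B -> (j < m)%nat -> Rabs (v j) < B.
Proof. intros H Hj; apply (nm_coord m v) in Hj; lra. Qed.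

Lemma nm_triang m u v : nm m (fun j => u j + v j) <= nm m u + nm m v.
Proof.
  pose proof (nm_pos m u); pose proof (nm_pos m v).
  apply nm_le; [lra|]; intros j Hj.
  pose proof (nm_coord m u j Hj); pose proof (nm_coord m v j Hj).
  pose proof (Rabs_triang (u j) (v j)); lra.
Qed.

Lemma nm_scal m c v : nm m (fun j => c * v j) <= Rabs c * nm m v.
Proof.
  apply nm_le; [apply Rmult_le_pos; [apply Rabs_pos|apply nm_pos]|].
  intros j Hj; rewrite Rabs_mult.
  apply Rmult_le_compat_l; [apply Rabs_pos|now apply nm_coord].
Qed.

Lemma nm_ext m u v : (forall j, (j < m)%nat -> u j = v j) -> nm m u = nm m v.
Proof. induction m; simpl; intros H; auto; rewrite IHm, H; auto. Qed.

(** * Cluster points and simultaneous Diophantine approximation *)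

Lemma inv_INR_lt e : 0 < e -> exists N, forall i, (N <= i)%nat -> / (INR i + 1) < e.
Proof.
  intros He; destruct (archimed_cor1 e He) as [N [H H0]].
  exists N; intros i Hi; eapply Rle_lt_trans; [|exact H].
  apply Rinv_le_contravar; [now apply lt_0_INR|].
  apply le_INR in Hi; lra.
Qed.

Lemma inv_INR_pos n : 0 < / (INR n + 1).
Proof. apply Rinv_0_lt_compat; pose proof (pos_INR n); lra. Qed.

(** Induction on the dimension: [phi] picks indices along which the first [m] coordinates converge,
    and the one-dimensional theorem is applied to the last coordinate along [phi]. Cluster points
    stand in for subsequences. *)
Lemma bolzano_weierstrass m (u : nat -> nat -> R) B :
  (forall i, nm m (u i) <= B) ->
  exists l, forall eta, 0 < eta -> forall N, exists i, (N <= i)%nat /\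
    nm m (fun j => u i j - l j) < eta.
Proof.
  induction m as [|m IH]; intros H.
  - exists (fun _ => 0); intros eta He N; exists N; simpl; auto.
  - destruct IH as [l Hl].
    { intros i; eapply Rle_trans; [|apply (H i)]; simpl; apply Rmax_l. }
    destruct (choice (fun i k => (i <= k)%nat /\
       nm m (fun j => u k j - l j) < / (INR i + 1))) as [phi Hphi].
    { intros i; apply Hl, inv_INR_pos. }
    destruct (Bolzano_Weierstrass (fun i => u (phi i) m) (fun c => -B <= c <= B))
      as [l' Hl'].
    { apply compact_P3. }
    { intros i; apply Rabs_le_between.
      eapply Rle_trans; [|apply (H (phi i))]; simpl; apply Rmax_r. }
    exists (fun j => if Nat.eq_dec j m then l' else l j).
    intros eta He N.
    destruct (inv_INR_lt eta He) as [N' HN'].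
    destruct (Hl' (fun c => Rabs (c - l') < eta) (max N N')) as [i [Hi Hd]].
    { exists (mkposreal eta He); intros c Hc; exact Hc. }
    destruct (Hphi i) as [Hi1 Hi2].
    exists (phi i); split; [lia|].
    simpl; apply Rmax_lub_lt.
    + rewrite (nm_ext _ _ (fun j => u (phi i) j - l j)).
      * eapply Rlt_trans; [exact Hi2|]; apply HN'; lia.
      * intros j Hj; destruct (Nat.eq_dec j m); [lia|auto].
    + destruct (Nat.eq_dec m m); [auto|lia].
Qed.

(** Instead of the pigeonhole principle, take two multiples of [v] whose fractional parts are near a
    common cluster point; their difference is nearly integral. *)
Lemma dirichlet m (v : nat -> R) eta : 0 < eta ->
  exists (N : nat) (a : nat -> Z), (1 <= N)%nat /\
    forall j, (j < m)%nat -> Rabs (INR N * v j - IZR (a j)) < eta.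
Proof.
  intros He.
  destruct (bolzano_weierstrass m (fun i j => frac_part (INR i * v j)) 1) as [l Hl].
  { intros i; apply nm_le; [lra|]; intros j _.
    pose proof (frac_bounds (INR i * v j)); rewrite Rabs_pos_eq; lra. }
  destruct (Hl (eta / 2) ltac:(lra) 0%nat) as [i [_ Hi]].
  destruct (Hl (eta / 2) ltac:(lra) (S i)) as [k [Hk Hk']].
  exists (k - i)%nat, (fun j => Int_part (INR k * v j) - Int_part (INR i * v j))%Z.
  split; [lia|]; intros j Hj.
  pose proof (nm_lt_coord _ _ _ j Hi Hj) as E1.
  pose proof (nm_lt_coord _ _ _ j Hk' Hj) as E2; simpl in E1, E2.
  rewrite minus_INR by lia; rewrite minus_IZR.
  replace ((INR k - INR i) * v j - (IZR (Int_part (INR k * v j)) - IZR (Int_part (INR i * v j))))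
    with ((frac_part (INR k * v j) - l j) - (frac_part (INR i * v j) - l j))
    by (unfold frac_part; ring).
  unfold Rminus at 1; eapply Rle_lt_trans; [apply Rabs_triang|].
  rewrite Rabs_Ropp; lra.
Qed.
(** * Compact connected subgroups *)

(** If [P] can be carried across every point of [0,1], it can be carried past the supremum of the
    points where it holds. This one principle yields both compactness and connectedness of
    circles. *)
Lemma real_induction (P : R -> Prop) :
  P 0 ->
  (forall s, 0 <= s <= 1 -> exists delta, 0 < delta /\
     forall x y, 0 <= x -> x <= s -> s <= y -> y <= 1 ->
       s - delta < x -> y < s + delta -> P x -> P y) ->
  P 1.
Proof.
  intros P0 H.
  destruct (completeness (fun s => 0 <= s <= 1 /\ P s)) as [c [Hc1 Hc2]].
  { exists 1; intros s [Hs _]; lra. }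
  { exists 0; split; [lra|auto]. }
  assert (C0 : 0 <= c) by (apply Hc1; split; [lra|auto]).
  assert (C1 : c <= 1) by (apply Hc2; intros s [Hs _]; lra).
  destruct (H c (conj C0 C1)) as [delta [Hd Hs]].
  destruct (classic (exists x, (0 <= x <= 1 /\ P x) /\ c - delta < x)) as [[x [[Hx Px] Hx']]|N].
  - assert (x <= c) by (apply Hc1; auto).
    destruct (Rle_dec (c + delta / 2) 1) as [L|L].
    + assert (P (c + delta / 2)) by (apply (Hs x); auto; lra).
      assert (c + delta / 2 <= c) by (apply Hc1; split; [lra|auto]); lra.
    + apply (Hs x); auto; lra.
  - exfalso.
    assert (c <= c - delta); [|lra].
    apply Hc2; intros x Hx.
    destruct (Rle_dec x (c - delta)); auto.
    exfalso; apply N; exists x; split; [auto|lra].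
Qed.

(** The sets where [phi i] exceeds 1/(n+1) form an open cover, and a finite subcover involves only
    finitely many n. This is the form in which compactness enters all later arguments by
    contradiction. *)
Lemma compact_uniform (K : TSet) {I : Type} (phi : I -> TN -> R) :
  Tcompact K ->
  (forall i x e, 0 < e -> exists delta, 0 < delta /\
     forall y, d x y < delta -> phi i x - e < phi i y) ->
  (forall x, K x -> exists i, 0 < phi i x) ->
  exists (l : list I) delta, 0 < delta /\
    forall x, K x -> exists i, In i l /\ delta < phi i x.
Proof.
  intros [Kc HK] Hphi Hcov.
  destruct (HK (I * nat)%type (fun p x => / (INR (snd p) + 1) < phi (fst p) x))
    as [l Hl].
  - intros [i n] x _ Hx; simpl in *.
    destruct (Hphi i x (phi i x - / (INR n + 1)) ltac:(lra)) as [delta [Hd H]].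
    exists delta; split; auto; intros y _ Hy; specialize (H y Hy); lra.
  - intros x Kx; destruct (Hcov x Kx) as [i Hi].
    destruct (inv_INR_lt _ Hi) as [N HN].
    exists (i, N); simpl; auto.
  - assert (exists N, forall p, In p l -> (snd p <= N)%nat) as [N HN].
    { clear; induction l as [|[i n] l [N HN]]; [exists O; simpl; tauto|].
      exists (max n N); intros p [<-|Hp]; simpl; [lia|].
      specialize (HN p Hp); lia. }
    exists (map fst l), (/ (INR N + 1)); split; [apply inv_INR_pos|].
    intros x Kx; destruct (Hl x Kx) as [[i n] [Hin Hi]]; simpl in Hi.
    exists i; split; [now apply (in_map fst) in Hin|].
    eapply Rle_lt_trans; [|exact Hi].
    apply Rinv_le_contravar; [pose proof (pos_INR n); lra|].
    apply Rplus_le_compat_r, le_INR, (HN _ Hin).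
Qed.

Lemma nt_lip h b u v : nt (IZR h * u - b) <= nt (IZR h * v - b) + Rabs (IZR h) * nt (u - v).
Proof.
  replace (IZR h * u - b) with ((IZR h * v - b) + IZR h * (u - v)) by ring.
  eapply Rle_trans; [apply nt_plus|].
  pose proof (nt_mulZ h (u - v)); lra.
Qed.

Lemma character_small h M e : 0 < e -> exists delta, 0 < delta /\
  forall x y : TN, d x y < delta -> Rabs (IZR h) * nt (x M - y M) < e.
Proof.
  intros He.
  assert (P : 0 < 2 ^ M) by (apply pow_lt; lra).
  pose proof (Rabs_pos (IZR h)) as A.
  exists (e / ((Rabs (IZR h) + 1) * 2 ^ M)); split.
  { apply Rdiv_lt_0_compat; nra. }
  intros x y H.
  apply (Rmult_lt_compat_l ((Rabs (IZR h) + 1) * 2 ^ M)) in H; [|nra].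
  replace ((Rabs (IZR h) + 1) * 2 ^ M * (e / ((Rabs (IZR h) + 1) * 2 ^ M)))
    with e in H by (field; lra).
  pose proof (d_coord x y M); pose proof (nt_pos (x M - y M)).
  nra.
Qed.

Lemma character_lsc h M b (x : TN) e : 0 < e -> exists delta, 0 < delta /\
  forall y, d x y < delta -> nt (IZR h * x M - b) - e < nt (IZR h * y M - b).
Proof.
  intros He; destruct (character_small h M e He) as [delta [Hd H]].
  exists delta; split; auto; intros y Hy.
  specialize (H x y Hy); pose proof (nt_lip h b (x M) (y M)); lra.
Qed.

(** [H] is stable under steps shorter than [delta], so both [H] and its complement are relatively
    open in [K]. *)
Lemma connected_chain (K H : TSet) delta x0 :
  Tconnected K -> 0 < delta ->
  (forall x y, K x -> K y -> d x y < delta -> H x -> H y) ->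
  K x0 -> H x0 -> forall x, K x -> H x.
Proof.
  intros HK Hd HH Kx0 Hx0 x Kx.
  apply NNPP; intros Hx; apply HK.
  exists (fun z => K z /\ H z), (fun z => K z /\ ~ H z).
  repeat apply conj; try tauto.
  - intros z [Kz Hz]; exists delta; split; auto; intros y Ky D; split; auto.
    now apply (HH z).
  - intros z [Kz Hz]; exists delta; split; auto; intros y Ky D; split; auto.
    intros Hy; apply Hz, (HH y); auto; now rewrite d_sym.
  - intros z Kz; destruct (classic (H z)); tauto.
  - now exists x0.
  - now exists x.
Qed.

Lemma tadd_isint x y n : isint (tadd x y n - (x n + y n)).
Proof.
  unfold tadd; replace (frac_part (x n + y n) - (x n + y n))
    with (- (x n + y n - frac_part (x n + y n))) by ring.
  apply isint_opp, frac_isint.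
Qed.

Lemma tneg_isint x n : isint (tneg x n - - x n).
Proof.
  unfold tneg; replace (frac_part (- x n) - - x n)
    with (- (- x n - frac_part (- x n))) by ring.
  apply isint_opp, frac_isint.
Qed.

Lemma subgroup_minus K x y : Tsubgroup K -> K x -> K y ->
  exists z, K z /\ forall n, isint (z n - (x n - y n)).
Proof.
  intros [_ [Ha Hn]] Kx Ky.
  exists (tadd x (tneg y)); split; auto.
  intros n.
  replace (tadd x (tneg y) n - (x n - y n))
    with ((tadd x (tneg y) n - (x n + tneg y n)) + (tneg y n - - y n)) by ring.
  apply isint_plus; [apply tadd_isint | apply tneg_isint].
Qed.

Lemma subgroup_mulZ K x k : Tsubgroup K -> K x ->
  exists z, K z /\ forall n, isint (z n - IZR k * x n).
Proof.
  intros [H0 [Ha Hn]] Kx.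
  assert (N : forall i : nat, exists z, K z /\ forall n, isint (z n - INR i * x n)).
  { induction i as [|i [z [Kz Hz]]].
    - exists tzero; split; auto; intros n; simpl INR; unfold tzero.
      rewrite Rmult_0_l, Rminus_diag; apply isint_0.
    - exists (tadd z x); split; auto; intros n; rewrite S_INR.
      replace (tadd z x n - (INR i + 1) * x n)
        with ((tadd z x n - (z n + x n)) + (z n - INR i * x n)) by ring.
      apply isint_plus; [apply tadd_isint | apply Hz]. }
  destruct (Z_le_gt_dec 0 k) as [L|L].
  - destruct (N (Z.to_nat k)) as [z Hz]; exists z.
    now rewrite INR_IZR_INZ, Z2Nat.id in Hz.
  - destruct (N (Z.to_nat (- k))) as [z [Kz Hz]].
    exists (tneg z); split; auto; intros n.
    rewrite INR_IZR_INZ, Z2Nat.id, opp_IZR in Hz by lia.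
    replace (tneg z n - IZR k * x n)
      with ((tneg z n - - z n) - (z n - - IZR k * x n)) by ring.
    apply isint_minus; [apply tneg_isint | apply Hz].
Qed.

(** * Approximating a connected subgroup by circles *)

(** The preimage in R^m of the projection of [K] to the first [m] coordinates. *)
Definition lift (K : TSet) (m : nat) (v : nat -> R) : Prop :=
  exists x, K x /\ forall j, (j < m)%nat -> isint (v j - x j).

(** The Lie algebra of that projection: the directions of its one-parameter subgroups. *)
Definition lines (K : TSet) (m : nat) (v : nat -> R) : Prop :=
  forall t, lift K m (fun j => t * v j).

Lemma lift_0 K m : Tsubgroup K -> lift K m (fun _ => 0).
Proof.
  intros [H0 _]; exists tzero; split; auto; intros; unfold tzero.
  rewrite Rminus_diag; apply isint_0.
Qed.

Lemma lift_ext K m u v : (forall j, (j < m)%nat -> u j = v j) -> lift K m u -> lift K m v.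
Proof. intros E [x [Kx Hx]]; exists x; split; auto; intros; rewrite <- E; auto. Qed.

Lemma lift_minus K m u v : Tsubgroup K -> lift K m u -> lift K m v ->
  lift K m (fun j => u j - v j).
Proof.
  intros G [x [Kx Hx]] [y [Ky Hy]].
  destruct (subgroup_minus K x y G Kx Ky) as [z [Kz Hz]].
  exists z; split; auto; intros j Hj.
  replace (u j - v j - z j) with ((u j - x j) - (v j - y j) - (z j - (x j - y j))) by ring.
  apply isint_minus; [apply isint_minus|]; auto.
Qed.

Lemma lift_plus K m u v : Tsubgroup K -> lift K m u -> lift K m v ->
  lift K m (fun j => u j + v j).
Proof.
  intros G Hu Hv.
  apply (lift_ext _ _ (fun j => u j - (0 - v j))); [intros; ring|].
  apply lift_minus; auto; apply (lift_minus _ _ (fun _ => 0)); auto using lift_0.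
Qed.

Lemma lift_mulZ K m u k : Tsubgroup K -> lift K m u -> lift K m (fun j => IZR k * u j).
Proof.
  intros G [x [Kx Hx]].
  destruct (subgroup_mulZ K x k G Kx) as [z [Kz Hz]].
  exists z; split; auto; intros j Hj.
  replace (IZR k * u j - z j) with (IZR k * (u j - x j) - (z j - IZR k * x j)) by ring.
  apply isint_minus; auto; apply isint_mult; auto using isint_IZR.
Qed.

(** If [v] is no lift, every point of [K] differs from [v] in some coordinate below [m]; compactness
    makes the gap uniform, which excludes lifts close to [v]. *)
Lemma lift_closed K m v : Tcompact K ->
  (forall eta, 0 < eta -> exists w, lift K m w /\ nm m (fun j => w j - v j) < eta) ->
  lift K m v.
Proof.
  intros HK H; apply NNPP; intros N.
  destruct (compact_uniform K
     (fun (p : {j : nat | (j < m)%nat}) x => nt (1 * x (proj1_sig p) - v (proj1_sig p))) HK)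
    as [l [delta [Hd Hl]]].
  - intros [j Hj] x e He; simpl.
    apply (character_lsc 1 j (v j) x e He).
  - intros x Kx; apply NNPP; intros Hx; apply N.
    exists x; split; auto; intros j Hj.
    apply isint_nt; rewrite nt_sym.
    apply NNPP; intros Hne; apply Hx; exists (exist _ j Hj); simpl.
    rewrite Rmult_1_l; pose proof (nt_pos (x j - v j)); lra.
  - destruct (H delta Hd) as [w [[x [Kx Hx]] Hw]].
    destruct (Hl x Kx) as [[j Hj] [_ Hj']]; simpl in Hj'.
    apply (nm_lt_coord _ _ _ j) in Hw; auto.
    rewrite Rmult_1_l, nt_sym, (nt_congr _ (v j - w j)) in Hj'.
    + rewrite nt_sym in Hj'; pose proof (nt_le_abs (w j - v j)); lra.
    + replace (v j - x j - (v j - w j)) with (w j - x j) by ring; auto.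
Qed.

Lemma lines_lift K m v : lines K m v -> lift K m v.
Proof. intros H; apply (lift_ext _ _ (fun j => 1 * v j)); auto; intros; ring. Qed.

Lemma lines_0 K m : Tsubgroup K -> lines K m (fun _ => 0).
Proof.
  intros G t; apply (lift_ext _ _ (fun _ => 0)); auto using lift_0; intros; ring.
Qed.

Lemma lines_plus K m u v : Tsubgroup K -> lines K m u -> lines K m v ->
  lines K m (fun j => u j + v j).
Proof.
  intros G Hu Hv t.
  apply (lift_ext _ _ (fun j => t * u j + t * v j)); [intros; ring|].
  apply lift_plus; auto.
Qed.

Lemma lines_scal K m c v : lines K m v -> lines K m (fun j => c * v j).
Proof.
  intros Hv t; apply (lift_ext _ _ (fun j => (t * c) * v j)); [intros; ring|auto].
Qed.

Lemma lines_closed K m v : Tcompact K ->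
  (forall eta, 0 < eta -> exists w, lines K m w /\ nm m (fun j => w j - v j) < eta) ->
  lines K m v.
Proof.
  intros HK H t; apply lift_closed; auto; intros eta He.
  pose proof (Rabs_pos t).
  destruct (H (eta / (Rabs t + 1))) as [w [Hw Hd]]; [apply Rdiv_lt_0_compat; lra|].
  exists (fun j => t * w j); split; auto.
  rewrite (nm_ext _ _ (fun j => t * (w j - v j))) by (intros; ring).
  eapply Rle_lt_trans; [apply nm_scal|].
  apply (Rmult_lt_compat_l (Rabs t + 1)) in Hd; [|lra].
  replace ((Rabs t + 1) * (eta / (Rabs t + 1))) with eta in Hd by (field; lra).
  pose proof (nm_pos m (fun j => w j - v j)); nra.
Qed.

(** Integer multiples of the ever shorter lifts [w i] step finely along their direction, so each
    [t * u] is a limit of lifts. *)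
Lemma lines_of_limit_direction K m (w : nat -> nat -> R) u :
  Tcompact K -> Tsubgroup K ->
  (forall i, lift K m (w i) /\ 0 < nm m (w i) < / (INR i + 1)) ->
  (forall eta, 0 < eta -> forall N, exists i, (N <= i)%nat /\
     nm m (fun j => w i j / nm m (w i) - u j) < eta) ->
  lines K m u.
Proof.
  intros HK G Hw Hu t; apply lift_closed; auto; intros eta He.
  pose proof (Rabs_pos t).
  destruct (inv_INR_lt (eta / 2)) as [N HN]; [lra|].
  destruct (Hu (eta / (2 * (Rabs t + 1)))) with (N := N) as [i [Hi Hd]].
  { apply Rdiv_lt_0_compat; lra. }
  destruct (Hw i) as [Hl [Hp Hs]]; specialize (HN i Hi).
  set (s := nm m (w i)) in *.
  (* Rounding [t / s] down costs less than one step, of length [s]; the remaining error is |t| times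
     the error in direction. *)
  exists (fun j => IZR (Int_part (t / s)) * w i j); split; [now apply lift_mulZ|].
  rewrite (nm_ext _ _ (fun j => t * (w i j / s - u j) + (- frac_part (t / s)) * w i j)).
  2:{ intros; unfold frac_part; field; lra. }
  eapply Rle_lt_trans; [apply nm_triang|].
  pose proof (nm_scal m t (fun j => w i j / s - u j)) as E1.
  pose proof (nm_scal m (- frac_part (t / s)) (w i)) as E2; fold s in E2.
  pose proof (frac_bounds (t / s)).
  rewrite Rabs_Ropp, (Rabs_pos_eq (frac_part _)) in E2 by lra.
  apply (Rmult_lt_compat_l (Rabs t + 1)) in Hd; [|lra].
  replace ((Rabs t + 1) * (eta / (2 * (Rabs t + 1)))) with (eta / 2) in Hd by (field; lra).
  pose proof (nm_pos m (fun j => w i j / s - u j)).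
  nra.
Qed.

(** The infimum of [E] is positive, so some element lies below twice the infimum. Reflecting [E]
    turns the infimum into a supremum. *)
Lemma almost_minimal (E : R -> Prop) a delta : 0 < delta -> E a -> (forall e, E e -> delta <= e) ->
  exists e, E e /\ forall e', E e' -> e < 2 * e'.
Proof.
  intros Hd Ha Hl.
  destruct (completeness (fun y => E (- y))) as [c [Hc1 Hc2]].
  { exists (- delta); intros y Hy; specialize (Hl _ Hy); lra. }
  { exists (- a); now rewrite Ropp_involutive. }
  assert (c <= - delta) by (apply Hc2; intros y Hy; specialize (Hl _ Hy); lra).
  apply NNPP; intros N.
  assert (c <= 2 * c); [|lra].
  apply Hc2; intros y Hy.
  apply Rnot_lt_le; intros L; apply N; exists (- y); split; auto.
  intros e' He'.
  assert (- e' <= c) by (apply Hc1; now rewrite Ropp_involutive); lra.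
Qed.

(* Otherwise there are lifts w tending to 0 that are within a factor 2 of
   their distance to [lines K m]; a limit u of the directions w / |w| lies in
   [lines K m], and |w| u approximates w too well. *)
Lemma small_lift_lines K m : Tcompact K -> Tsubgroup K ->
  exists rho, 0 < rho /\ forall v, lift K m v -> nm m v < rho -> lines K m v.
Proof.
  intros HK G; apply NNPP; intros N.
  assert (W : forall i : nat, exists w, (lift K m w /\ 0 < nm m w < / (INR i + 1)) /\
     forall v, lines K m v -> nm m w < 2 * nm m (fun j => w j - v j)).
  { intros i.
    (* Half the bound is required of [y] because subtracting an almost nearest vector of [lines K m]
       may double the norm. *)
    assert (exists y, lift K m y /\ nm m y < / (INR i + 1) / 2 /\ ~ lines K m y) as [y [Hy [Hs Hn]]].
    { apply NNPP; intros N'; apply N; exists (/ (INR i + 1) / 2); split.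
      { pose proof (inv_INR_pos i); lra. }
      intros v Hv Hs; apply NNPP; intros Hn; apply N'; now exists v. }
    assert (exists delta, 0 < delta /\
       forall v, lines K m v -> delta <= nm m (fun j => y j - v j)) as [delta [Hd Hl]].
    { apply NNPP; intros N'; apply Hn, lines_closed; auto; intros eta He.
      apply NNPP; intros N''; apply N'; exists eta; split; auto; intros v Hv.
      apply Rnot_lt_le; intros L; apply N''; exists v; split; auto.
      eapply Rle_lt_trans; [|exact L].
      rewrite (nm_ext _ _ (fun j => (-1) * (y j - v j))) by (intros; ring).
      eapply Rle_trans; [apply nm_scal|].
      rewrite Rabs_left by lra; lra. }
    destruct (almost_minimal (fun e => exists v, lines K m v /\ e = nm m (fun j => y j - v j))
      (nm m y) delta Hd) as [e [[v [Hv ->]] Hmin]].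
    { exists (fun _ => 0); split; [now apply lines_0|].
      apply nm_ext; intros; ring. }
    { intros e [v [Hv ->]]; auto. }
    exists (fun j => y j - v j); split; [split|].
    - apply lift_minus; auto; now apply lines_lift.
    - split; [specialize (Hl v Hv); lra|].
      assert (nm m (fun j => y j - v j) < 2 * nm m y); [|lra].
      apply Hmin; exists (fun _ => 0); split; [now apply lines_0|].
      apply nm_ext; intros; ring.
    - intros v' Hv'; apply Hmin; exists (fun j => v j + v' j); split.
      + now apply lines_plus.
      + apply nm_ext; intros; ring. }
  apply choice in W; destruct W as [w Hw].
  destruct (bolzano_weierstrass m (fun i j => w i j / nm m (w i)) 1) as [u Hu].
  { intros i; destruct (Hw i) as [[_ [Hp _]] _].
    rewrite (nm_ext _ _ (fun j => / nm m (w i) * w i j)) by (intros; field; lra).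
    eapply Rle_trans; [apply nm_scal|].
    rewrite Rabs_pos_eq by (left; now apply Rinv_0_lt_compat).
    rewrite Rinv_l; lra. }
  assert (Lu : lines K m u).
  { apply (lines_of_limit_direction K m w u); auto; intros i; apply Hw. }
  destruct (Hu (/ 2) ltac:(lra) O) as [i [_ Hi]].
  destruct (Hw i) as [[_ [Hp _]] Hm].
  (* The vector |w| u is tested against almost-minimality: its distance to w is below |w|/2. *)
  specialize (Hm _ (lines_scal _ _ (nm m (w i)) _ Lu)).
  set (s := nm m (w i)) in *.
  rewrite (nm_ext _ _ (fun j => s * (w i j / s - u j))) in Hm by (intros; field; lra).
  pose proof (nm_scal m s (fun j => w i j / s - u j)) as E.
  rewrite Rabs_pos_eq in E by lra.
  nra.
Qed.

(** Connectedness joins [tzero] to [x] by small steps; each step lifts to a short vector, hence to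
    one in [lines K m], and these vectors add up. *)
Lemma connected_lines K m x : inC K -> K x ->
  exists v, lines K m v /\ forall j, (j < m)%nat -> isint (v j - x j).
Proof.
  intros [[HK _] [G Hc]].
  destruct (small_lift_lines K m HK G) as [rho [Hr Hs]].
  assert (P : 0 < 2 ^ m) by (apply pow_lt; lra).
  (* At distance below [rho / 2 ^ m], each of the first [m] coordinates moves by less than [rho]. *)
  revert x; apply (connected_chain K _ (rho / 2 ^ m) tzero); auto.
  - apply Rdiv_lt_0_compat; auto.
  - intros x y Kx Ky D [v [Hv Hx]].
    destruct (choice (fun n k => nt (y n - x n) = Rabs (y n - x n - IZR k))) as [k Hk].
    { intros n; apply nt_ex. }
    exists (fun j => v j + (y j - x j - IZR (k j))); split.
    + apply lines_plus; auto; apply Hs.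
      * destruct (subgroup_minus K y x G Ky Kx) as [z [Kz Hz]].
        exists z; split; auto; intros j _.
        replace (y j - x j - IZR (k j) - z j) with (- IZR (k j) - (z j - (y j - x j))) by ring.
        apply isint_minus; auto; apply isint_opp, isint_IZR.
      * apply nm_lt; auto; intros j Hj.
        rewrite <- Hk; rewrite nt_sym.
        eapply Rle_lt_trans; [apply d_coord|].
        apply (Rmult_lt_compat_l (2 ^ m)) in D; auto.
        replace (2 ^ m * (rho / 2 ^ m)) with rho in D by (field; lra).
        assert (2 ^ j <= 2 ^ m) by (apply Rle_pow; [lra|lia]).
        pose proof (d_pos x y); nra.
    + intros j Hj.
      replace (v j + (y j - x j - IZR (k j)) - y j) with ((v j - x j) - IZR (k j)) by ring.
      apply isint_minus; auto using isint_IZR.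
  - apply G.
  - exists (fun _ => 0); split; [now apply lines_0|].
    intros; unfold tzero; rewrite Rminus_diag; apply isint_0.
Qed.

(** Induction on the list. With [a] a circle for the tail and b/N close to [v], the circle a + Q b
    winds rapidly along [v] while drifting slowly along [a]. *)
Lemma circle_through K m (l : list (nat -> R)) :
  Tsubgroup K -> (forall v, In v l -> lines K m v) ->
  forall eta, 0 < eta -> exists a : nat -> Z,
    (forall t, exists x, K x /\ forall j, (j < m)%nat -> nt (IZR (a j) * t - x j) < eta) /\
    (forall v, In v l -> exists t, forall j, (j < m)%nat -> nt (IZR (a j) * t - v j) < eta).
Proof.
  intros G; induction l as [|v l IH]; intros Hl eta He.
  { exists (fun _ => 0%Z); split; [|intros v []].
    intros t; exists tzero; split; [apply G|]; intros j _.
    rewrite nt_isint; auto; unfold tzero; rewrite Rmult_0_l, Rminus_0_r; apply isint_0. }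
  destruct (IH (fun v' Hv' => Hl v' (or_intror Hv')) (eta / 4) ltac:(lra)) as [a [Ha1 Ha2]].
  pose proof (Hl v (or_introl eq_refl)) as Lv.
  destruct (dirichlet m v (eta / 4) ltac:(lra)) as [N [b [HN Hb]]].
  apply le_INR in HN; change (INR 1) with 1 in HN.
  pose proof (nm_pos m (fun j => IZR (a j))) as Ap.
  (* [Q] is so large that the circle [a] moves by less than [eta / 4] in each coordinate during a
     time of at most 1/Q. *)
  destruct (INR_unbounded (1 + nm m (fun j => IZR (a j)) / (eta / 4))) as [Q HQ].
  assert (0 <= nm m (fun j => IZR (a j)) / (eta / 4))
    by (apply Rmult_le_pos; [auto | left; apply Rinv_0_lt_compat; lra]).
  assert (HA : forall j c, (j < m)%nat -> 0 <= c <= / INR Q -> Rabs (IZR (a j) * c) < eta / 4).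
  { intros j c Hj [Hc0 Hc].
    pose proof (nm_coord m (fun j => IZR (a j)) j Hj) as B; simpl in B.
    assert (E : nm m (fun j => IZR (a j)) < eta / 4 * INR Q).
    { assert (E : nm m (fun j => IZR (a j)) / (eta / 4) < INR Q) by lra.
      apply (Rmult_lt_compat_l (eta / 4)) in E; [|lra].
      replace (eta / 4 * (nm m (fun j => IZR (a j)) / (eta / 4)))
        with (nm m (fun j => IZR (a j))) in E by (field; lra); auto. }
    rewrite Rabs_mult, (Rabs_pos_eq c) by auto.
    apply Rle_lt_trans with (nm m (fun j => IZR (a j)) * / INR Q).
    - apply Rmult_le_compat; auto using Rabs_pos.
    - apply (Rmult_lt_compat_r (/ INR Q)) in E; [|apply Rinv_0_lt_compat; lra].
      replace (eta / 4 * INR Q * / INR Q) with (eta / 4) in E by (field; lra); auto. }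
  exists (fun j => a j + Z.of_nat Q * b j)%Z; split.
  - intros t; destruct (Ha1 t) as [x [Kx Hx]].
    (* Modulo 1 the term Q b t equals b times the fractional part of [s], which stays close to the
       point with parameter [frac_part s * INR N] on the line of [v]. *)
    set (s := INR Q * t).
    destruct (Lv (frac_part s * INR N)) as [x' [Kx' Hx']].
    exists (tadd x x'); split; [now apply G|]; intros j Hj.
    specialize (Hx j Hj); specialize (Hx' j Hj); specialize (Hb j Hj); simpl in Hx'.
    rewrite plus_IZR, mult_IZR, <- INR_IZR_INZ.
    rewrite (nt_congr _ ((IZR (a j) * t - x j) + frac_part s * (IZR (b j) - INR N * v j))).
    + eapply Rle_lt_trans; [apply nt_plus|].
      pose proof (nt_le_abs (frac_part s * (IZR (b j) - INR N * v j))) as E.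
      rewrite Rabs_mult, (Rabs_minus_sym (IZR (b j))) in E.
      pose proof (frac_bounds s); rewrite (Rabs_pos_eq (frac_part s)) in E by lra.
      pose proof (Rabs_pos (INR N * v j - IZR (b j))); nra.
    + replace (((IZR (a j) + INR Q * IZR (b j)) * t - tadd x x' j) -
          ((IZR (a j) * t - x j) + frac_part s * (IZR (b j) - INR N * v j)))
        with (IZR (b j) * (s - frac_part s) + (frac_part s * INR N * v j - x' j)
              - (tadd x x' j - (x j + x' j))) by (unfold s; ring).
      apply isint_minus; [apply isint_plus|apply tadd_isint]; auto.
      apply isint_mult; auto using isint_IZR, frac_isint.
  - intros v' [<-|Hv'].
    (* At this time the fast term is exactly b/N, close to [v], and the slow term is negligible. *)
    + exists (/ (INR N * INR Q)); intros j Hj; specialize (Hb j Hj).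
      rewrite plus_IZR, mult_IZR, <- INR_IZR_INZ.
      replace ((IZR (a j) + INR Q * IZR (b j)) * / (INR N * INR Q) - v j)
        with (IZR (a j) * / (INR N * INR Q) + - (/ INR N * (INR N * v j - IZR (b j))))
        by (field; lra).
      eapply Rle_lt_trans; [apply nt_plus|]; rewrite nt_opp.
      pose proof (nt_le_abs (IZR (a j) * / (INR N * INR Q))).
      pose proof (nt_le_abs (/ INR N * (INR N * v j - IZR (b j)))) as E.
      assert (/ INR N <= 1) by (rewrite <- Rinv_1; apply Rinv_le_contravar; lra).
      assert (0 < / INR N) by (apply Rinv_0_lt_compat; lra).
      rewrite Rabs_mult, (Rabs_pos_eq (/ INR N)) in E by lra.
      pose proof (Rabs_pos (INR N * v j - IZR (b j))).
      assert (Rabs (IZR (a j) * / (INR N * INR Q)) < eta / 4); [|nra].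
      apply HA; auto; split.
      * left; apply Rinv_0_lt_compat; nra.
      * apply Rinv_le_contravar; nra.
    + destruct (Ha2 v' Hv') as [t0 Ht0].
      (* Moving [t0] back by at most 1/Q makes Q t an integer, so the fast term vanishes modulo
         1. *)
      exists (t0 - frac_part (INR Q * t0) * / INR Q); intros j Hj; specialize (Ht0 j Hj).
      rewrite plus_IZR, mult_IZR, <- INR_IZR_INZ.
      set (c := frac_part (INR Q * t0) * / INR Q).
      assert (Hc : 0 <= c <= / INR Q).
      { assert (0 < / INR Q) by (apply Rinv_0_lt_compat; lra).
        pose proof (frac_bounds (INR Q * t0)); unfold c; split; nra. }
      rewrite (nt_congr _ ((IZR (a j) * t0 - v' j) + - (IZR (a j) * c))).
      * eapply Rle_lt_trans; [apply nt_plus|]; rewrite nt_opp.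
        pose proof (nt_le_abs (IZR (a j) * c)); specialize (HA j c Hj Hc); lra.
      * replace ((IZR (a j) + INR Q * IZR (b j)) * (t0 - c) - v' j -
           (IZR (a j) * t0 - v' j + - (IZR (a j) * c)))
          with (IZR (b j) * (INR Q * t0 - frac_part (INR Q * t0)))
          by (unfold c; field; lra).
        apply isint_mult; auto using isint_IZR, frac_isint.
Qed.

(** A finite net of [K] is lifted to vectors in [lines K m], and one circle is passed near all of
    them. *)
Lemma circle_approx K m eta : inC K -> 0 < eta -> exists a : nat -> Z,
  (forall t, exists x, K x /\ forall j, (j < m)%nat -> nt (IZR (a j) * t - x j) < eta) /\
  (forall x, K x -> exists t, forall j, (j < m)%nat -> nt (IZR (a j) * t - x j) < eta).
Proof.
  intros HK He; pose proof HK as [[Kc _] [G _]].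
  assert (P : 0 < 2 ^ m) by (apply pow_lt; lra).
  set (rho := eta / 2 / 2 ^ m).
  assert (Hr : 0 < rho) by (apply Rdiv_lt_0_compat; lra).
  destruct (compact_uniform K (fun (z : {z | K z}) x => rho - d (proj1_sig z) x) Kc)
    as [l [delta [Hd Hl]]].
  - intros [z Kz] x e Hee; exists e; split; auto; intros y Hy; simpl.
    pose proof (d_triang z x y); lra.
  - intros x Kx; exists (exist _ x Kx); simpl.
    rewrite d_refl; lra.
  - destruct (choice (fun (z : {z | K z}) v => lines K m v /\
        forall j, (j < m)%nat -> isint (v j - proj1_sig z j))) as [v Hv].
    { intros [z Kz]; now apply connected_lines. }
    destruct (circle_through K m (map v l) G) with (eta := eta / 2) as [a [Ha1 Ha2]]; [|lra|].
    { intros w Hw; apply in_map_iff in Hw; destruct Hw as [z [<- _]]; apply Hv. }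
    exists a; split.
    + intros t; destruct (Ha1 t) as [x [Kx Hx]]; exists x; split; auto.
      intros j Hj; specialize (Hx j Hj); lra.
    + intros x Kx; destruct (Hl x Kx) as [z [Hz Hzx]]; simpl in Hzx.
      destruct (Ha2 (v z)) as [t Ht]; [now apply in_map|].
      exists t; intros j Hj.
      specialize (Ht j Hj); destruct (Hv z) as [_ Hvz]; specialize (Hvz j Hj).
      eapply Rle_lt_trans; [apply (nt_triang _ (v z j))|].
      assert (nt (v z j - x j) < eta / 2); [|lra].
      rewrite (nt_congr _ (proj1_sig z j - x j)).
      * eapply Rle_lt_trans; [apply d_coord|].
        assert (2 ^ j <= 2 ^ m) by (apply Rle_pow; [lra|lia]).
        assert (D : d (proj1_sig z) x < rho) by lra.
        apply (Rmult_lt_compat_l (2 ^ m)) in D; auto.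
        replace (2 ^ m * rho) with (eta / 2) in D by (unfold rho; field; lra).
        pose proof (d_pos (proj1_sig z) x); nra.
      * replace (v z j - x j - (proj1_sig z j - x j)) with (v z j - proj1_sig z j) by ring; auto.
Qed.

(** * Circles as compact connected subgroups *)

Definition circle_point (A : nat -> Z) (t : R) : TN := fun n => frac_part (IZR (A n) * t).

Definition circle (A : nat -> Z) : TSet := fun x => exists t, x = circle_point A t.

Lemma circle_point_cont A e : 0 < e -> exists delta, 0 < delta /\
  forall s t, Rabs (s - t) < delta -> d (circle_point A s) (circle_point A t) < e.
Proof.
  intros He; destruct (d_small e He) as [m [eta [Heta H]]].
  pose proof (nm_pos m (fun j => IZR (A j))) as P.
  exists (eta / (nm m (fun j => IZR (A j)) + 1)); split; [apply Rdiv_lt_0_compat; lra|].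
  intros s t D; apply H; intros j Hj; unfold circle_point.
  rewrite frac_nt, <- Rmult_minus_distr_l.
  eapply Rle_lt_trans; [apply nt_le_abs|]; rewrite Rabs_mult.
  pose proof (nm_coord m (fun j => IZR (A j)) j Hj) as B; simpl in B.
  apply (Rmult_lt_compat_l (nm m (fun j => IZR (A j)) + 1)) in D; [|lra].
  replace ((nm m (fun j => IZR (A j)) + 1) * (eta / (nm m (fun j => IZR (A j)) + 1)))
    with eta in D by (field; lra).
  pose proof (Rabs_pos (s - t)); nra.
Qed.

Lemma circle_point_canon A t : canon (circle_point A t).
Proof. intros n; apply frac_bounds. Qed.

Lemma circle_point_frac A t : circle_point A t = circle_point A (frac_part t).
Proof.
  apply functional_extensionality; intros n; apply frac_eq.
  rewrite <- Rmult_minus_distr_l; apply isint_mult; auto using isint_IZR, frac_isint.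
Qed.

(** The circle is the image of [0,1]; real induction extends a finite cover of the arc over [0,s] by
    one more open set. *)
Lemma circle_compact A : Tcompact (circle A).
Proof.
  split; [intros x [t ->]; apply circle_point_canon|].
  intros I U HU Hcov.
  destruct (real_induction (fun s => exists l : list I,
     forall t, 0 <= t <= s -> exists i, In i l /\ U i (circle_point A t))) as [l Hl].
  - destruct (Hcov (circle_point A 0)) as [i Hi]; [now exists 0|].
    exists (i :: nil); intros t Ht; exists i; split; [now left|].
    now replace t with 0 by lra.
  - intros s Hs; destruct (Hcov (circle_point A s)) as [i Hi]; [now exists s|].
    destruct (HU i _ (circle_point_canon A s) Hi) as [eps [He Hu]].
    destruct (circle_point_cont A eps He) as [delta [Hd Hc]].
    exists delta; split; auto.
    intros x y H0 Hx Hy H1 Hxd Hyd [l Hl].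
    exists (i :: l); intros t Ht.
    destruct (Rle_dec t x) as [L|L].
    + destruct (Hl t ltac:(lra)) as [k [Hk Hk']]; exists k; split; [now right|auto].
    + exists i; split; [now left|]; apply Hu; [apply circle_point_canon|].
      apply Hc; apply Rabs_def1; lra.
  - exists l; intros x [t ->]; rewrite circle_point_frac; apply Hl.
    pose proof (frac_bounds t); lra.
Qed.

Lemma circle_no_separation A (B C : TSet) :
  rel_open (circle A) B -> rel_open (circle A) C ->
  (forall x, circle A x -> B x \/ C x) -> (forall x, ~ (B x /\ C x)) ->
  B (circle_point A 0) -> forall T, ~ C (circle_point A T).
Proof.
  intros HB HC Hcov Hdis B0 T CT.
  (* The path from parameter 0 to [T] is rescaled to [0,1]; near each of its points it lies wholly
     in [B] or wholly in [C]. *)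
  assert (BT : B (circle_point A (1 * T))); [|rewrite Rmult_1_l in BT; exact (Hdis _ (conj BT CT))].
  apply (real_induction (fun s => B (circle_point A (s * T)))); [now rewrite Rmult_0_l|].
  intros s Hs.
  pose proof (Rabs_pos T).
  assert (exists eps, 0 < eps /\ ((forall t, d (circle_point A (s * T)) (circle_point A t) < eps -> B (circle_point A t))
     \/ (forall t, d (circle_point A (s * T)) (circle_point A t) < eps -> C (circle_point A t))))
    as [eps [He Hbc]].
  { destruct (Hcov (circle_point A (s * T))) as [H1|H1]; [now exists (s * T)| |].
    - destruct (HB _ H1) as [eps [He Hb]]; exists eps; split; auto; left.
      intros t Ht; apply Hb; auto; now exists t.
    - destruct (HC _ H1) as [eps [He Hb]]; exists eps; split; auto; right.
      intros t Ht; apply Hb; auto; now exists t. }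
  destruct (circle_point_cont A eps He) as [delta [Hd Hc]].
  assert (D : forall x, Rabs (s - x) < delta / (Rabs T + 1) ->
     d (circle_point A (s * T)) (circle_point A (x * T)) < eps).
  { intros x Hx; apply Hc; rewrite <- Rmult_minus_distr_r, Rabs_mult.
    apply (Rmult_lt_compat_r (Rabs T + 1)) in Hx; [|lra].
    replace (delta / (Rabs T + 1) * (Rabs T + 1)) with delta in Hx by (field; lra).
    pose proof (Rabs_pos (s - x)); nra. }
  exists (delta / (Rabs T + 1)); split; [apply Rdiv_lt_0_compat; lra|].
  intros x y H0 Hx Hy H1 Hxd Hyd Bx.
  destruct Hbc as [Hbc|Hbc].
  - apply Hbc, D; apply Rabs_def1; lra.
  - exfalso; apply (Hdis (circle_point A (x * T))); split; auto.
    apply Hbc, D; apply Rabs_def1; lra.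
Qed.

Lemma circle_inC A : inC (circle A).
Proof.
  split; [split; [apply circle_compact|exists (circle_point A 0); now exists 0]|].
  split; [split; [|split]|].
  - exists 0; apply functional_extensionality; intros n; unfold tzero, circle_point.
    rewrite Rmult_0_r, frac_id; lra.
  - intros x y [s ->] [t ->]; exists (s + t).
    apply functional_extensionality; intros n; unfold tadd, circle_point.
    apply frac_eq.
    replace (frac_part (IZR (A n) * s) + frac_part (IZR (A n) * t) - IZR (A n) * (s + t))
      with (- (IZR (A n) * s - frac_part (IZR (A n) * s)
               + (IZR (A n) * t - frac_part (IZR (A n) * t)))) by ring.
    apply isint_opp, isint_plus; apply frac_isint.
  - intros x [s ->]; exists (- s).
    apply functional_extensionality; intros n; unfold tneg, circle_point.
    apply frac_eq.
    replace (- frac_part (IZR (A n) * s) - IZR (A n) * - s)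
      with (IZR (A n) * s - frac_part (IZR (A n) * s)) by ring.
    apply frac_isint.
  - intros [B [C [HB [HC [SB [SC [Hcov [Hdis [[b Hb] [c Hc]]]]]]]]]].
    destruct (Hcov (circle_point A 0)) as [H0|H0]; [now exists 0| |].
    + destruct (SC c Hc) as [T ->].
      apply (circle_no_separation A B C HB HC Hcov Hdis H0 T Hc).
    + destruct (SB b Hb) as [T ->].
      refine (circle_no_separation A C B HC HB _ _ H0 T Hb).
      * intros x Hx; destruct (Hcov x Hx); auto.
      * intros x [Cx Bx]; apply (Hdis x); auto.
Qed.

(** * A residual class of subgroups *)

Lemma dH_lt_inv K L r : Rbar_lt (dH K L) (Finite r) ->
  nbhd_contains K r L /\ nbhd_contains L r K.
Proof.
  intros H; unfold dH in H.
  match type of H with Rbar_lt (Glb_Rbar ?E) _ =>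
    destruct (Glb_Rbar_correct E) as [_ Hg];
    destruct (classic (exists e, E e /\ e < r)) as [[e [[He [H1 H2]] Hr]]|N] end.
  - split; intros x Hx.
    + destruct (H1 x Hx) as [y [Hy D]]; exists y; split; auto; lra.
    + destruct (H2 x Hx) as [y [Hy D]]; exists y; split; auto; lra.
  - exfalso; apply (Rbar_lt_not_le _ _ H), Hg.
    intros e He; simpl; apply Rnot_lt_le; intros L'; apply N; now exists e.
Qed.

Lemma dH_lt K L e r : 0 < e < r -> nbhd_contains K e L -> nbhd_contains L e K ->
  Rbar_lt (dH K L) (Finite r).
Proof.
  intros He H1 H2; apply Rbar_le_lt_trans with (Finite e); [|simpl; lra].
  unfold dH; match goal with |- Rbar_le (Glb_Rbar ?E) _ =>
    destruct (Glb_Rbar_correct E) as [Hg _] end.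
  apply Hg; repeat split; auto; lra.
Qed.

(** Needed because the trivial group satisfies [cyclic_divisible n] for all [n] without being a
    solenoid. *)
Definition nontrivial (K : TSet) : Prop := exists x j, K x /\ x j <> 0.

(* On a subgroup the bound 1/4 forces [x j = n! * k j * x M] in T: dually,
   the first n coordinate characters are n!-multiples of multiples of a single
   one.  The weaker inequality makes the condition open. *)
Definition cyclic_divisible (n : nat) (K : TSet) : Prop :=
  exists M (k : nat -> Z), forall x, K x -> forall j, (j < n)%nat ->
    nt (x j - IZR (Z.of_nat (fact n) * k j) * x M) < / 4.

(** Every ball contains a circle that is good at level [n], together with all groups sufficiently
    near it; such a circle is not in the closure of the bad set. *)
Lemma cyclic_divisible_generic n :
  nowhere_dense_C (fun K => ~ (nontrivial K /\ cyclic_divisible n K)).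
Proof.
  intros [K [r [HK [Hr H]]]].
  destruct (d_small (r / 2) ltac:(lra)) as [m0 [eta [He Hm0]]].
  set (m := max m0 n).
  destruct (circle_approx K m eta HK He) as [a [Ha1 Ha2]].
  set (F := Z.of_nat (fact n)).
  assert (HF : IZR F <> 0).
  { unfold F; rewrite <- INR_IZR_INZ; apply INR_fact_neq_0. }
  (* Coordinate [m] carries the parameter itself, so on this circle x_j is congruent to F a_j x_m
     for all j < m: goodness with [M] = [m] and [k] = [a]. *)
  set (A := fun j => if lt_dec j m then (F * a j)%Z else if Nat.eq_dec j m then 1%Z else 0%Z).
  assert (A1 : forall j, (j < m)%nat -> A j = (F * a j)%Z).
  { intros j Hj; unfold A; destruct (lt_dec j m); [auto|lia]. }
  assert (Am : A m = 1%Z).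
  { unfold A; destruct (lt_dec m m); [lia|]; destruct (Nat.eq_dec m m); [auto|lia]. }
  assert (HL : Rbar_lt (dH K (circle A)) (Finite r)).
  { apply dH_lt with (r / 2); [lra| |].
    - intros x [t ->]; destruct (Ha1 (IZR F * t)) as [y [Ky Hy]].
      exists y; split; auto; rewrite d_sym; apply Hm0; intros j Hj.
      assert (j < m)%nat by (unfold m; lia).
      eapply Rle_lt_trans; [|apply (Hy j); auto]; right.
      apply nt_congr; unfold circle_point; rewrite A1, mult_IZR by auto.
      match goal with |- isint (frac_part ?z - _ - _) =>
        replace (frac_part z - y j - (IZR (a j) * (IZR F * t) - y j))
        with (- (z - frac_part z)) by ring end.
      apply isint_opp, frac_isint.
    - intros x Kx; destruct (Ha2 x Kx) as [t Ht].
      exists (circle_point A (t / IZR F)); split; [now eexists|].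
      apply Hm0; intros j Hj.
      assert (j < m)%nat by (unfold m; lia).
      eapply Rle_lt_trans; [|apply (Ht j); auto]; right.
      apply nt_congr; unfold circle_point; rewrite A1, mult_IZR by auto.
      replace (IZR F * IZR (a j) * (t / IZR F)) with (IZR (a j) * t) by (field; auto).
      match goal with |- isint (frac_part ?z - _ - _) =>
        replace (frac_part z - x j - (z - x j)) with (- (z - frac_part z)) by ring end.
      apply isint_opp, frac_isint. }
  destruct (H _ (circle_inC A) HL) as [_ Hcl].
  pose proof (nm_pos m (fun j => IZR (A j))) as Cp.
  set (C := nm m (fun j => IZR (A j))) in *.
  assert (P : 0 < 2 ^ m) by (apply pow_lt; lra).
  (* With this radius the errors u in coordinate j and v in coordinate [m] satisfy (1+C)u < 1/4 and
     (1+C)v < 1/4, hence u + C v < 1/4. *)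
  destruct (Hcl (/ (4 * 2 ^ m * (1 + C)))) as [L [_ [HN HD]]].
  { apply Rinv_0_lt_compat; nra. }
  apply HN; clear HN; apply dH_lt_inv in HD; destruct HD as [D1 D2].
  assert (E : forall x y j, (j <= m)%nat -> d x y < / (4 * 2 ^ m * (1 + C)) ->
     (1 + C) * nt (x j - y j) < / 4).
  { intros x y j Hj D.
    apply (Rmult_lt_compat_l (2 ^ m * (1 + C))) in D; [|nra].
    replace (2 ^ m * (1 + C) * / (4 * 2 ^ m * (1 + C))) with (/ 4) in D by (field; lra).
    pose proof (d_coord x y j); pose proof (d_pos x y).
    assert (2 ^ j <= 2 ^ m) by (apply Rle_pow; [lra|lia]).
    assert (nt (x j - y j) <= 2 ^ m * d x y) by nra.
    nra. }
  split.
  (* Coordinate [m] equals 1/2 at this point, too far from 0 for a nearby point of [L] to vanish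
     there. *)
  - destruct (D2 (circle_point A (/ 2))) as [x [Lx Hx]]; [now eexists|].
    exists x, m; split; auto; intros X0.
    specialize (E _ _ m (le_n _) Hx).
    unfold circle_point in E; rewrite Am, Rmult_1_l, X0, frac_id in E by lra.
    pose proof (nt_pos (0 - / 2)).
    rewrite Rminus_0_l, nt_opp, nt_abs, Rabs_pos_eq in * by
      (try rewrite Rabs_pos_eq; lra).
    nra.
  - exists m, a; intros x Lx j Hj.
    assert (Hjm : (j < m)%nat) by (unfold m; lia).
    destruct (D1 x Lx) as [y [[t ->] Hy]].
    pose proof (E _ _ j (Nat.lt_le_incl _ _ Hjm) Hy) as Ej.
    pose proof (E _ _ m (le_n _) Hy) as Em.
    fold F; rewrite <- A1 by auto.
    set (y := circle_point A t) in *.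
    assert (Hyj : isint (y j - IZR (A j) * y m)).
    { unfold y, circle_point; rewrite Am, Rmult_1_l.
      replace (frac_part (IZR (A j) * t) - IZR (A j) * frac_part t)
        with (IZR (A j) * (t - frac_part t) - (IZR (A j) * t - frac_part (IZR (A j) * t))) by ring.
      apply isint_minus; [apply isint_mult|]; auto using isint_IZR, frac_isint. }
    replace (x j - IZR (A j) * x m)
      with ((x j - y j) + ((y j - IZR (A j) * y m) + IZR (A j) * (y m - x m))) by ring.
    eapply Rle_lt_trans; [apply nt_plus|].
    rewrite (nt_congr (_ + _) (IZR (A j) * (y m - x m)))
      by (match goal with |- isint (?u + ?v - ?v) => now replace (u + v - v) with u by ring end).
    rewrite nt_sym.
    pose proof (nt_mulZ (A j) (y m - x m)).
    pose proof (nm_coord m (fun j => IZR (A j)) j Hjm) as B; simpl in B; fold C in B.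
    pose proof (nt_pos (y j - x j)); pose proof (nt_pos (y m - x m)).
    set (u := nt (y j - x j)) in *; set (v := nt (y m - x m)) in *.
    assert (Rabs (IZR (A j)) * v <= C * v) by (apply Rmult_le_compat_r; auto).
    apply Rle_lt_trans with (u + C * v); [lra|].
    assert (C * ((1 + C) * v) <= C * / 4) by (apply Rmult_le_compat_l; lra).
    apply (Rmult_lt_reg_l (1 + C)); lra.
Qed.

(** * Groups in the residual class are universal solenoids *)

(** Along small steps from [tzero] the character changes by less than [delta]; each change is its
    value at the difference of two points of [K], hence zero in T. *)
Lemma character_zero K h M h' M' delta : inC K -> 0 < delta ->
  (forall x, K x -> nt (IZR h * x M - IZR h' * x M') < delta ->
     isint (IZR h * x M - IZR h' * x M')) ->
  forall x, K x -> isint (IZR h * x M - IZR h' * x M').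
Proof.
  intros [_ [G Hc]] Hd H.
  destruct (character_small h M (delta / 2) ltac:(lra)) as [d1 [Hd1 H1]].
  destruct (character_small h' M' (delta / 2) ltac:(lra)) as [d2 [Hd2 H2]].
  apply (connected_chain K _ (Rmin d1 d2) tzero); auto.
  - now apply Rmin_glb_lt.
  - intros x y Kx Ky D Hx.
    pose proof (Rlt_le_trans _ _ _ D (Rmin_l d1 d2)) as D1.
    pose proof (Rlt_le_trans _ _ _ D (Rmin_r d1 d2)) as D2.
    rewrite d_sym in D1, D2; apply H1 in D1; apply H2 in D2.
    destruct (subgroup_minus K y x G Ky Kx) as [z [Kz Hz]].
    assert (E : isint (IZR h * z M - IZR h' * z M' -
       (IZR h * (y M - x M) + - (IZR h' * (y M' - x M'))))).
    { replace (IZR h * z M - IZR h' * z M' - (IZR h * (y M - x M) + - (IZR h' * (y M' - x M'))))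
        with (IZR h * (z M - (y M - x M)) - IZR h' * (z M' - (y M' - x M'))) by ring.
      apply isint_minus; apply isint_mult; auto using isint_IZR. }
    assert (Z : isint (IZR h * z M - IZR h' * z M')).
    { apply H; auto; rewrite (nt_congr _ _ E).
      eapply Rle_lt_trans; [apply nt_plus|]; rewrite nt_opp.
      pose proof (nt_mulZ h (y M - x M)); pose proof (nt_mulZ h' (y M' - x M')); lra. }
    replace (IZR h * y M - IZR h' * y M') with
      ((IZR h * z M - IZR h' * z M') - (IZR h * z M - IZR h' * z M' -
       (IZR h * (y M - x M) + - (IZR h' * (y M' - x M')))) + (IZR h * x M - IZR h' * x M')) by ring.
    apply isint_plus; auto; now apply isint_minus.
  - apply G.
  - unfold tzero; rewrite !Rmult_0_r, Rminus_diag; apply isint_0.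
Qed.

(** The dual of a connected group is torsion-free: a value of the character within 1/|D| of an
    integer k gives an integer D(c - k) of absolute value below 1, so it is zero and
    [character_zero] applies. *)
Lemma character_torsion_free K D h M h' M' : inC K -> (D <> 0)%Z ->
  (forall x, K x -> isint (IZR D * (IZR h * x M - IZR h' * x M'))) ->
  forall x, K x -> isint (IZR h * x M - IZR h' * x M').
Proof.
  intros HK HD H.
  assert (P : 0 < Rabs (IZR D)) by (apply Rabs_pos_lt; now apply eq_IZR_contrapositive).
  apply (character_zero K h M h' M' (/ Rabs (IZR D))); auto.
  { now apply Rinv_0_lt_compat. }
  intros x Kx; specialize (H x Kx).
  set (c := IZR h * x M - IZR h' * x M') in *; intros Hs.
  destruct (nt_ex c) as [k Hk]; rewrite Hk in Hs.
  assert (E : isint (IZR D * (c - IZR k))).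
  { rewrite Rmult_minus_distr_l; apply isint_minus; auto.
    apply isint_mult; apply isint_IZR. }
  destruct E as [q Hq].
  assert (q = 0)%Z as ->.
  { assert (Z.abs q < 1)%Z; [|lia].
    apply lt_IZR; rewrite abs_IZR, <- Hq, Rabs_mult.
    apply (Rmult_lt_compat_l (Rabs (IZR D))) in Hs; auto.
    rewrite Rinv_r in Hs; lra. }
  apply Rmult_integral in Hq; destruct Hq as [Hq|Hq].
  - now apply eq_IZR in Hq.
  - exists k; lra.
Qed.

(** A nontrivial character on a connected group takes arbitrarily small nonzero values modulo 1;
    their multiples are dense in T, and compactness makes the image closed. *)
Lemma character_onto K h M : inC K ->
  (exists x, K x /\ ~ isint (IZR h * x M)) ->
  forall y, exists x, K x /\ isint (IZR h * x M - y).
Proof.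
  intros HK [x0 [Kx0 Hx0]] y; pose proof HK as [[Kc _] [G _]].
  apply NNPP; intros N.
  destruct (compact_uniform K (fun (_ : unit) x => nt (IZR h * x M - y)) Kc)
    as [l [delta [Hd Hl]]].
  - intros _ x e He; now apply character_lsc.
  - intros x Kx; exists tt.
    destruct (Rle_lt_or_eq_dec _ _ (nt_pos (IZR h * x M - y))) as [L|L]; auto.
    exfalso; apply N; exists x; split; auto; now apply isint_nt.
  - assert (exists x, K x /\ nt (IZR h * x M) < delta /\ ~ isint (IZR h * x M))
      as [x [Kx [Hx Hi]]].
    { apply NNPP; intros N'; apply Hx0.
      replace (IZR h * x0 M) with (IZR h * x0 M - IZR 0 * x0 M) by ring.
      apply (character_zero K h M 0 M delta); auto.
      intros x Kx; replace (IZR h * x M - IZR 0 * x M) with (IZR h * x M) by ring.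
      intros Hx; apply NNPP; intros Hi; apply N'; now exists x. }
    destruct (nt_ex (IZR h * x M)) as [k Hk]; rewrite Hk in Hx.
    set (e := IZR h * x M - IZR k) in *.
    assert (He : e <> 0).
    { intros E; apply Hi; exists k; unfold e in E; lra. }
    (* The multiple q e misses [y] by less than |e|, which is below the gap [delta]. *)
    set (q := Int_part (y / e)).
    destruct (subgroup_mulZ K x q G Kx) as [z [Kz Hz]].
    destruct (Hl z Kz) as [_ [_ L]].
    rewrite (nt_congr _ (- (frac_part (y / e) * e))) in L.
    + rewrite nt_opp in L.
      pose proof (nt_le_abs (frac_part (y / e) * e)) as B.
      pose proof (frac_bounds (y / e)); pose proof (Rabs_pos e).
      rewrite Rabs_mult, (Rabs_pos_eq (frac_part _)) in B by lra; nra.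
    + replace (IZR h * z M - y - - (frac_part (y / e) * e))
        with (IZR h * (z M - IZR q * x M) + IZR q * IZR k)
        by (unfold frac_part; fold q;
            replace (IZR h * (z M - IZR q * x M) + IZR q * IZR k) with
              (IZR h * z M - IZR q * e) by (unfold e; ring); field; auto).
      apply isint_plus; apply isint_mult; auto using isint_IZR.
Qed.

(** Passing from x to its multiple q x multiplies the error by q, so all multiples of the error stay
    below 1/4. *)
Lemma cyclic_divisible_eq K n : Tsubgroup K -> cyclic_divisible n K ->
  exists M (k : nat -> Z), forall x, K x -> forall j, (j < n)%nat ->
    isint (x j - IZR (Z.of_nat (fact n) * k j) * x M).
Proof.
  intros G [M [k H]]; exists M, k; intros x Kx j Hj.
  apply isint_of_small_multiples; intros q.
  destruct (subgroup_mulZ K x q G Kx) as [z [Kz Hz]].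
  rewrite (nt_congr _ (z j - IZR (Z.of_nat (fact n) * k j) * z M)); auto.
  set (c := IZR (Z.of_nat (fact n) * k j)).
  replace (IZR q * (x j - c * x M) - (z j - c * z M))
    with (c * (z M - IZR q * x M) - (z j - IZR q * x j)) by ring.
  apply isint_minus; auto; apply isint_mult; auto; apply isint_IZR.
Qed.

(** * A universal sequence of primes and its products *)

(* i minus the largest square below i takes each value infinitely often. *)
Definition all_primes (i : nat) : nat :=
  let q := (i - Nat.sqrt i * Nat.sqrt i)%nat in
  if prime_dec (Z.of_nat q) then q else 2%nat.

Lemma all_primes_universal : universal_prime_seq all_primes.
Proof.
  split.
  - intros i; unfold all_primes; destruct prime_dec; auto; apply prime_2.
  (* Since q is at most s, the square root of s^2 + q is [s], and the offset is exactly [q]. *)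
  - intros q Hq N; set (s := max N q).
    exists (s * s + q)%nat; split; [unfold s; nia|].
    unfold all_primes; rewrite (Nat.sqrt_unique (s * s + q) s) by (unfold s; nia).
    replace (s * s + q - s * s)%nat with q by lia.
    destruct prime_dec; tauto.
Qed.

(** Multiplication by this number is the composite bonding map from stage i + l to stage i of the
    inverse system. *)
Fixpoint prod_from (p : nat -> nat) (i l : nat) : Z :=
  match l with O => 1 | S l => prod_from p i l * Z.of_nat (p (i + l)%nat) end.

Lemma prod_from_add p i l l' :
  prod_from p i (l + l') = (prod_from p i l * prod_from p (i + l) l')%Z.
Proof.
  induction l' as [|l' IH]; simpl; [rewrite Nat.add_0_r; ring|].
  rewrite Nat.add_succ_r; simpl; rewrite IH, Nat.add_assoc; ring.
Qed.

(** Strong induction on [D]: a prime occurs at some index from [i] on, and the two factors of a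
    composite number are found in consecutive blocks. *)
Lemma divide_prod_from p : universal_prime_seq p ->
  forall D i, (1 <= D)%nat -> exists l, (Z.of_nat D | prod_from p i l)%Z.
Proof.
  intros [_ Hp] D; induction D as [D IH] using lt_wf_ind; intros i HD.
  destruct (Nat.eq_dec D 1) as [->|H1]; [exists O; apply Z.divide_refl|].
  destruct (prime_dec (Z.of_nat D)) as [P|P].
  - destruct (Hp D P i) as [i' [Hi <-]].
    exists (S (i' - i)); simpl.
    replace (i + (i' - i))%nat with i' by lia; apply Z.divide_factor_r.
  - destruct (not_prime_divide (Z.of_nat D)) as [n [Hn [q Hq]]]; [lia|auto|].
    destruct (IH (Z.to_nat n)) with (i := i) as [l Hl]; [lia|lia|].
    destruct (IH (Z.to_nat q)) with (i := (i + l)%nat) as [l' Hl']; [nia|nia|].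
    exists (l + l')%nat; rewrite prod_from_add, Hq, Z.mul_comm.
    rewrite Z2Nat.id in Hl, Hl' by nia.
    apply Z.divide_trans with (n * prod_from p (i + l) l')%Z;
      [now apply Z.mul_divide_mono_l | now apply Z.mul_divide_mono_r].
Qed.

Lemma factor_of_fact q n : (1 <= q <= n)%nat -> exists c, fact n = (q * c)%nat.
Proof.
  induction n as [|n IH]; intros H; [lia|].
  destruct (Nat.eq_dec q (S n)) as [->|E]; [now exists (fact n)|].
  destruct IH as [c Hc]; [lia|]; exists (S n * c)%nat.
  change (fact (S n)) with (S n * fact n)%nat; rewrite Hc; ring.
Qed.

Lemma dependent_choice {A : Type} (a0 : A) (R : nat -> A -> A -> Prop) :
  (forall n a, exists b, R n a b) ->
  exists f : nat -> A, f O = a0 /\ forall n, R n (f n) (f (S n)).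
Proof.
  intros H.
  destruct (choice (fun (p : nat * A) b => R (fst p) (snd p) b)) as [s Hs]; [now intros [n a]; apply H|].
  exists (nat_rect _ a0 (fun n a => s (n, a))); split; auto.
  intros n; apply (Hs (n, _)).
Qed.

(** * The isomorphism onto the solenoid of [p] *)

Section solenoid_coordinates.

Variables (K : TSet) (p : nat -> nat) (M : nat -> nat) (h : nat -> Z).

Hypothesis K_inC : inC K.
Hypothesis p_universal : universal_prime_seq p.
Hypothesis K_cyclic_divisible : forall n, cyclic_divisible n K.
Hypothesis h_0 : h O = 1%Z.
Hypothesis M_0_nonzero : exists x, K x /\ x (M O) <> 0.
Hypothesis h_root : forall i x, K x ->
  isint (IZR (h i) * x (M i) - INR (p i) * (IZR (h (S i)) * x (M (S i)))).

Let f (x : TN) : TN := fun i => frac_part (IZR (h i) * x (M i)).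

Lemma first_coordinate i x : K x ->
  isint (x (M O) - IZR (prod_from p 0 i) * (IZR (h i) * x (M i))).
Proof.
  intros Kx; induction i as [|i IH]; simpl prod_from.
  - rewrite h_0, !Rmult_1_l, Rminus_diag; apply isint_0.
  - rewrite mult_IZR, <- INR_IZR_INZ; simpl plus.
    match goal with |- isint ?z => replace z with
      (x (M O) - IZR (prod_from p 0 i) * (IZR (h i) * x (M i)) +
       IZR (prod_from p 0 i) * (IZR (h i) * x (M i) - INR (p i) * (IZR (h (S i)) * x (M (S i)))))
      by ring end.
    apply isint_plus; auto; apply isint_mult; auto using isint_IZR.
Qed.

Lemma first_coordinate_nontrivial : exists x, K x /\ ~ isint (x (M O)).
Proof.
  destruct M_0_nonzero as [x [Kx Hx]]; exists x; split; auto; intros H; apply Hx.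
  destruct K_inC as [[[Kc _] _] _].
  apply isint_lt1_eq; [now apply Kc|lra|now rewrite Rminus_0_r].
Qed.

(* With [x j = n! k_j x_N] and [x (M 0) = D x_N], universality makes D divide
   some product [p_0 ... p_(l-1)], so that [D (x_N - Q h_l x_(M l))] vanishes
   on K, and torsion-freeness removes the factor D. *)
Lemma coordinates_separate z : K z ->
  (forall i, isint (IZR (h i) * z (M i))) -> forall j, isint (z j).
Proof.
  intros Kz Hz j; pose proof K_inC as [_ [G _]].
  destruct (cyclic_divisible_eq K (S (max j (M O))) G) as [N [k Hk]]; auto.
  set (F := Z.of_nat (fact (S (max j (M O))))) in *.
  set (D := (F * k (M O))%Z) in *.
  assert (HD : D <> 0%Z).
  { intros E; destruct first_coordinate_nontrivial as [x [Kx Hx]]; apply Hx.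
    specialize (Hk x Kx (M O) ltac:(lia)); fold D in Hk.
    now rewrite E, Rmult_0_l, Rminus_0_r in Hk. }
  destruct (divide_prod_from p p_universal (Z.to_nat (Z.abs D)) 0 ltac:(lia)) as [l Hl].
  rewrite Z2Nat.id, Z.divide_abs_l in Hl by lia; destruct Hl as [Q HQ].
  assert (E : isint (IZR 1 * z N - IZR (Q * h l) * z (M l))).
  { apply (character_torsion_free K D); auto; intros x Kx.
    pose proof (Hk x Kx (M O) ltac:(lia)) as E1; fold D in E1.
    pose proof (first_coordinate l x Kx) as E2; rewrite HQ, mult_IZR in E2.
    rewrite mult_IZR.
    match goal with |- isint ?u => match type of E1 with isint ?v =>
      match type of E2 with isint ?w => replace u with (w - v) by ring end end end.
    now apply isint_minus. }
  rewrite Rmult_1_l, mult_IZR, Rmult_assoc in E.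
  assert (ZN : isint (z N)).
  { replace (z N) with (z N - IZR Q * (IZR (h l) * z (M l)) + IZR Q * (IZR (h l) * z (M l))) by ring.
    apply isint_plus; auto; apply isint_mult; auto using isint_IZR. }
  specialize (Hk z Kz j ltac:(lia)).
  replace (z j) with (z j - IZR (F * k j) * z N + IZR (F * k j) * z N) by ring.
  apply isint_plus; auto; apply isint_mult; auto using isint_IZR.
Qed.

Lemma solenoid_map_inj x y : K x -> K y ->
  (forall i, isint (IZR (h i) * x (M i) - IZR (h i) * y (M i))) -> x = y.
Proof.
  intros Kx Ky H; pose proof K_inC as [[[Kc _] _] [G _]].
  destruct (subgroup_minus K x y G Kx Ky) as [z [Kz Hz]].
  apply functional_extensionality; intros j.
  apply isint_lt1_eq; [now apply Kc|now apply Kc|].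
  replace (x j - y j) with (z j - (z j - (x j - y j))) by ring.
  apply isint_minus; auto.
  apply coordinates_separate; auto; intros i.
  replace (IZR (h i) * z (M i)) with (IZR (h i) * (z (M i) - (x (M i) - y (M i))) +
    (IZR (h i) * x (M i) - IZR (h i) * y (M i))) by ring.
  apply isint_plus; auto; apply isint_mult; auto using isint_IZR.
Qed.

Lemma solenoid_map_mem x : K x -> solenoid p (f x).
Proof.
  intros Kx; split; [intros i; apply frac_bounds|].
  intros i; unfold f; apply frac_eq.
  set (b := IZR (h (S i)) * x (M (S i))).
  match goal with |- isint (?u - ?v * ?w) => replace (u - v * w)
    with ((u - v * b) + v * (b - w)) by ring end.
  apply isint_plus; [now apply h_root|].
  apply isint_mult; [apply isint_INR|apply frac_isint].
Qed.

(** By compactness finitely many coordinates suffice. Prescribing the one of largest index is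
    possible by [character_onto], and the bonding relations then force all earlier ones. *)
Lemma solenoid_map_onto y : solenoid p y ->
  exists x, K x /\ forall i, isint (IZR (h i) * x (M i) - y i).
Proof.
  intros [_ Hy]; apply NNPP; intros N; pose proof K_inC as [[Kc _] _].
  destruct (compact_uniform K (fun i x => nt (IZR (h i) * x (M i) - y i)) Kc)
    as [l [delta [Hd Hl]]].
  - intros i x e He; now apply character_lsc.
  - intros x Kx; apply NNPP; intros N'; apply N; exists x; split; auto; intros i.
    apply isint_nt; apply NNPP; intros Hi; apply N'; exists i.
    pose proof (nt_pos (IZR (h i) * x (M i) - y i)); lra.
  - destruct (character_onto K (h (list_max l)) (M (list_max l)) K_inC)
      with (y := y (list_max l)) as [x [Kx Hx]].
    { destruct first_coordinate_nontrivial as [x [Kx Hx]]; exists x; split; auto.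
      intros Hi; apply Hx.
      pose proof (first_coordinate (list_max l) x Kx) as E.
      match type of E with isint (?u - ?v * ?w) => replace u with ((u - v * w) + v * w) by ring end.
      apply isint_plus; auto; apply isint_mult; auto using isint_IZR. }
    assert (D : forall n i, (i + n = list_max l)%nat -> isint (IZR (h i) * x (M i) - y i)).
    { induction n as [|n IH]; intros i Hi.
      - rewrite Nat.add_0_r in Hi; now rewrite Hi.
      - specialize (IH (S i) ltac:(lia)).
        rewrite (Hy i).
        set (u := INR (p i) * y (S i)).
        replace (IZR (h i) * x (M i) - frac_part u) with
          ((IZR (h i) * x (M i) - INR (p i) * (IZR (h (S i)) * x (M (S i)))) +
           INR (p i) * (IZR (h (S i)) * x (M (S i)) - y (S i)) + (u - frac_part u))
          by (unfold u; ring).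
        apply isint_plus; [apply isint_plus|apply frac_isint]; auto.
        apply isint_mult; auto using isint_INR. }
    destruct (Hl x Kx) as [i [Hi Li]].
    rewrite nt_isint in Li; [lra|].
    assert (List.Forall (fun k => (k <= list_max l)%nat) l) as B by now apply list_max_le.
    rewrite List.Forall_forall in B; specialize (B i Hi).
    apply (D (list_max l - i)%nat); lia.
Qed.

Lemma solenoid_map_cont : cont_on K f.
Proof.
  intros x Kx eps He.
  destruct (d_small eps He) as [m [eta [Heta Hm]]].
  assert (exists delta, 0 < delta /\ forall y, d x y < delta ->
    forall j, (j < m)%nat -> Rabs (IZR (h j)) * nt (x (M j) - y (M j)) < eta)
    as [delta [Hd H]].
  { clear Hm; induction m as [|m [d1 [Hd1 H1]]]; [exists 1; split; [lra|lia]|].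
    destruct (character_small (h m) (M m) eta Heta) as [d2 [Hd2 H2]].
    exists (Rmin d1 d2); split; [now apply Rmin_glb_lt|].
    intros y D j Hj.
    destruct (Nat.eq_dec j m) as [->|].
    - apply H2; eapply Rlt_le_trans; [exact D|apply Rmin_r].
    - apply H1; [eapply Rlt_le_trans; [exact D|apply Rmin_l]|lia]. }
  exists delta; split; auto; intros y Ky D; apply Hm; intros j Hj.
  unfold f; rewrite frac_nt, <- Rmult_minus_distr_l.
  eapply Rle_lt_trans; [apply nt_mulZ|]; now apply H.
Qed.

(** Compactness of [K] and injectivity: points of [K] away from [g y0] differ from [y0], by a
    uniform amount, in one of finitely many solenoid coordinates. *)
Lemma solenoid_inverse_cont g :
  (forall y, solenoid p y -> K (g y) /\ forall i, isint (IZR (h i) * g y (M i) - y i)) ->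
  cont_on (solenoid p) g.
Proof.
  intros Hg y0 Sy0 eps He; pose proof K_inC as [[Kc _] _].
  destruct (Hg y0 Sy0) as [Kx0 Hx0].
  (* [None] stands for the ball around [g y0], and [Some i] for points whose i-th solenoid
     coordinate differs from that of [y0]. *)
  destruct (compact_uniform K (fun o x => match o with
      | None => eps - d (g y0) x
      | Some i => nt (IZR (h i) * x (M i) - y0 i) end) Kc) as [l [delta [Hd Hl]]].
  - intros [i|] x e Hee; [now apply character_lsc|].
    exists e; split; auto; intros y Hy.
    pose proof (d_triang (g y0) x y); lra.
  - intros x Kx; apply NNPP; intros N.
    assert (E : g y0 = x).
    { apply solenoid_map_inj; auto; intros i.
      replace (IZR (h i) * g y0 (M i) - IZR (h i) * x (M i)) with
        ((IZR (h i) * g y0 (M i) - y0 i) - (IZR (h i) * x (M i) - y0 i)) by ring.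
      apply isint_minus; auto; apply isint_nt, NNPP; intros Hi.
      apply N; exists (Some i); pose proof (nt_pos (IZR (h i) * x (M i) - y0 i)); lra. }
    apply N; exists None; rewrite E, d_refl; lra.
  - assert (exists n, forall i, In (Some i) l -> (i <= n)%nat) as [n Hn].
    { clear; induction l as [|[i|] l [n Hn]]; [exists O; simpl; tauto| |].
      - exists (max i n); intros k [[= <-]|Hk]; [lia|]; specialize (Hn k Hk); lia.
      - exists n; intros k [[=]|Hk]; auto. }
    assert (P : 0 < 2 ^ n) by (apply pow_lt; lra).
    exists (delta / 2 ^ n); split; [now apply Rdiv_lt_0_compat|].
    intros y Sy D; destruct (Hg y Sy) as [Kx Hx].
    destruct (Hl (g y) Kx) as [[i|] [Hi Li]]; [exfalso|lra].
    rewrite (nt_congr _ (y i - y0 i)) in Li.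
    + apply (Rmult_lt_compat_l (2 ^ n)) in D; auto.
      replace (2 ^ n * (delta / 2 ^ n)) with delta in D by (field; lra).
      rewrite nt_sym in Li; pose proof (d_coord y0 y i).
      assert (2 ^ i <= 2 ^ n) by (apply Rle_pow; [lra|auto]).
      pose proof (d_pos y0 y); nra.
    + replace (IZR (h i) * g y (M i) - y0 i - (y i - y0 i))
        with (IZR (h i) * g y (M i) - y i) by ring; auto.
Qed.

Lemma solenoid_coordinates_iso : top_group_iso K (solenoid p).
Proof.
  destruct (choice (fun y x => solenoid p y -> K x /\ forall i, isint (IZR (h i) * x (M i) - y i)))
    as [g Hg].
  { intros y; destruct (classic (solenoid p y)) as [Sy|Sy]; [|exists tzero; tauto].
    destruct (solenoid_map_onto y Sy) as [x Hx]; now exists x. }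
  assert (FG : forall y, solenoid p y -> forall n, f (g y) n = y n).
  { intros y Sy n; destruct (Hg y Sy) as [_ H].
    unfold f; rewrite <- (frac_id (y n)) by apply Sy; now apply frac_eq. }
  exists f, g; repeat apply conj.
  - exact solenoid_map_mem.
  - intros y Sy; now apply Hg.
  - intros x Kx n; pose proof (solenoid_map_mem x Kx) as Sx.
    destruct (Hg (f x) Sx) as [Kg H].
    rewrite (solenoid_map_inj (g (f x)) x); auto; intros i.
    match goal with |- isint (?u - ?v) => replace (u - v) with ((u - f x i) - (v - f x i)) by ring end.
    apply isint_minus; auto; apply frac_isint.
  - exact FG.
  - intros x y Kx Ky n; unfold f, tadd at 2; apply frac_eq.
    set (u := IZR (h n) * x (M n)); set (v := IZR (h n) * y (M n)).
    replace (IZR (h n) * tadd x y (M n) - (frac_part u + frac_part v)) with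
      (IZR (h n) * (tadd x y (M n) - (x (M n) + y (M n))) +
       ((u - frac_part u) + (v - frac_part v))) by (unfold u, v; ring).
    apply isint_plus; [apply isint_mult|apply isint_plus];
      auto using isint_IZR, frac_isint, tadd_isint.
  - exact solenoid_map_cont.
  - exact (solenoid_inverse_cont g Hg).
Qed.

End solenoid_coordinates.

(** The sequence of characters starts at a nonzero coordinate and is continued by dependent choice,
    each entry being a p_i-th root of the previous one. *)
Lemma cyclic_divisible_iso K : inC K -> nontrivial K -> (forall n, cyclic_divisible n K) ->
  iso_universal_solenoid K.
Proof.
  intros HK [x0 [j0 [Kx0 Hx0]]] HP; pose proof HK as [_ [G _]].
  exists all_primes; split; [exact all_primes_universal|].
  destruct (dependent_choice (j0, 1%Z) (fun i c c' => forall x, K x ->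
     isint (IZR (snd c) * x (fst c) - INR (all_primes i) * (IZR (snd c') * x (fst c')))))
    as [c [Hc0 Hc]].
  - intros i [M h]; simpl.
    set (q := all_primes i).
    assert (Hq : (1 <= q)%nat).
    { pose proof (proj1 all_primes_universal i) as P; apply prime_ge_2 in P; unfold q; lia. }
    (* The level is at least [q], so that [q] divides its factorial, and exceeds [M], so that it
       covers coordinate [M]. *)
    destruct (cyclic_divisible_eq K (max q (S M)) G (HP _)) as [M' [k Hk]].
    destruct (factor_of_fact q (max q (S M)) ltac:(lia)) as [b Hb].
    exists (M', (h * Z.of_nat b * k M)%Z); intros x Kx; simpl.
    specialize (Hk x Kx M ltac:(lia)).
    rewrite Hb, Nat2Z.inj_mul, !mult_IZR, <- (INR_IZR_INZ q) in Hk.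
    rewrite !mult_IZR.
    match type of Hk with isint ?u => match goal with |- isint ?v =>
      replace v with (IZR h * u) by ring end end.
    apply isint_mult; auto using isint_IZR.
  - apply (solenoid_coordinates_iso K all_primes (fun i => fst (c i)) (fun i => snd (c i)));
      auto using all_primes_universal.
    + now rewrite Hc0.
    + rewrite Hc0; now exists x0.
Qed.

Theorem theorem3p7 : comeager_C iso_universal_solenoid.
Proof.
  (* Nontriviality is built into every level, so avoiding all these sets gives both hypotheses of
     [cyclic_divisible_iso]. *)
  exists (fun n K => ~ (nontrivial K /\ cyclic_divisible n K)); split.
  - exact cyclic_divisible_generic.
  - intros K HK HN; apply NNPP; intros N; apply HN.
    assert (H : forall n, nontrivial K /\ cyclic_divisible n K).
    { intros n; apply NNPP; intros Hn; apply N; now exists n. }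
    apply cyclic_divisible_iso; auto; [apply (H O)|intros n; apply H].
Qed.
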